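(* The following are equivalent over $\mathsf{RCA}_0$: (i) Given any family of open sets $U_{ni}$ (for $n,i\in\mathbb N$) with $[0,1]\subseteq\bigcup_{i\in\mathbb N}U_{ni}$ for all $n\in\mathbb N$, there is a function $h\colon\mathbb N\to\mathbb N$ such that all $n\in\mathbb N$ validate $[0,1]\subseteq\bigcup_{i\leq h(n)}U_{ni}$. (ii) Arithmetical comprehension (i.e., the main axiom of $\mathsf{ACA}_0$).
   Context: $\mathsf{RCA}_0$ is the usual base system of second-order arithmetic (basic arithmetic axioms, $\Sigma^0_1$-induction, $\Delta^0_1$-comprehension). ''Equivalent over $\mathsf{RCA}_0$'' means that the equivalence, formalized in second-order arithmetic, is provable in $\mathsf{RCA}_0$. Arithmetical comprehension asserts that $\{n\in\mathbb N:\varphi(n)\}$ exists for each arithmetical formula $\varphi$ (with parameters). Reals. A real is a Cauchy sequence $x=(x_n)_{n\in\mathbb N}$ of rationals with no rate of convergence given: for each rational $\varepsilon>0$ there is an $N\in\mathbb N$ with $|x_m-x_n|<\varepsilon$ for all $m,n\geq N$. For reals $x,y$: $x\leq y$ means that for each rational $\varepsilon>0$ there is an $N$ with $x_n\leq y_n+\varepsilon$ for all $n\geq N$; $x=y$ means $x\leq y$ and $y\leq x$; $x<y$ means $x\leq y$ but not $x=y$. Addition, multiplication and absolute value are defined pointwise; rationals are identified with constant sequences. Put $B_\delta(y)=\{z\in\mathbb R:|y-z|<\delta\}$ and $[0,1]=\{x\in\mathbb R:0\leq x\leq 1\}$. Open sets. A code for an open set is a set $U\subseteq\mathbb N\times\mathbb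 Q\times\mathbb Q_{>0}$. For a real $x$, write $x\in U$ if there are $N\in\mathbb N$ and $(a,r)\in\mathbb Q\times\mathbb Q_{>0}$ such that $x\in B_r(a)$ and $(n,a,r)\in U$ for all $n\geq N$. A family of open sets is a family of codes (coded as a single set). *)

(* Defs.v *)
(* Standard library only. The language of second-order arithmetic and its
   provability relation are deeply embedded: "provable in RCA_0" is the
   existence of a formal derivation. *)
From Stdlib Require Import List.

(** * Second-order arithmetic *)

(* De Bruijn indices, with separate index spaces for number variables
   ([TVar], bound by [All]) and set variables (the [nat] in [Mem], bound by
   [SAll]). The logic is classical, so the other connectives are defined. *)
Inductive term : Type :=
| TVar (n : nat)
| TZero
| TOne
| TAdd (s t : term)
| TMul (s t : term).

Inductive form : Type :=
| Bot
| Imp (p q : form)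
| Eq (s t : term)
| Lt (s t : term)
| Mem (t : term) (X : nat)
| All (p : form)
| SAll (p : form).

Definition Neg (p : form) : form := Imp p Bot.
Definition And (p q : form) : form := Neg (Imp p (Neg q)).
Definition Or (p q : form) : form := Imp (Neg p) q.
Definition Iff (p q : form) : form := And (Imp p q) (Imp q p).
Definition Ex (p : form) : form := Neg (All (Neg p)).
Definition SEx (p : form) : form := Neg (SAll (Neg p)).

Definition scons {A : Type} (a : A) (s : nat -> A) (n : nat) : A :=
  match n with O => a | S m => s m end.

Fixpoint tsubst (s : nat -> term) (t : term) : term :=
  match t with
  | TVar n => s n
  | TZero => TZero
  | TOne => TOne
  | TAdd t1 t2 => TAdd (tsubst s t1) (tsubst s t2)
  | TMul t1 t2 => TMul (tsubst s t1) (tsubst s t2)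
  end.

Definition tshift : term -> term := tsubst (fun n => TVar (S n)).

(* [fsubst s r p]: capture-avoiding simultaneous substitution of terms for the
   free number variables and renaming of the free set variables. *)
Fixpoint fsubst (s : nat -> term) (r : nat -> nat) (p : form) : form :=
  match p with
  | Bot => Bot
  | Imp p1 p2 => Imp (fsubst s r p1) (fsubst s r p2)
  | Eq t1 t2 => Eq (tsubst s t1) (tsubst s t2)
  | Lt t1 t2 => Lt (tsubst s t1) (tsubst s t2)
  | Mem t X => Mem (tsubst s t) (r X)
  | All p1 => All (fsubst (scons (TVar 0) (fun n => tshift (s n))) r p1)
  | SAll p1 => SAll (fsubst s (scons 0 (fun n => S (r n))) p1)
  end.

Definition nshift : form -> form := fsubst (fun n => TVar (S n)) (fun n => n).
Definition sshift : form -> form := fsubst TVar S.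
Definition inst (t : term) : form -> form :=
  fsubst (scons t TVar) (fun n => n).
Definition sinst (Y : nat) : form -> form := fsubst TVar (scons Y (fun n => n)).

(* Natural deduction for classical two-sorted logic with equality of numbers.
   Members of the theory [T] may have free variables and are then understood
   as universally closed: [prv_allI] and [prv_sallI] shift only the local
   hypotheses [G]. *)
Inductive prv (T : form -> Prop) : list form -> form -> Prop :=
| prv_ax G p : T p -> prv T G p
| prv_hyp G p : In p G -> prv T G p
| prv_impI G p q : prv T (p :: G) q -> prv T G (Imp p q)
| prv_impE G p q : prv T G (Imp p q) -> prv T G p -> prv T G q
| prv_raa G p : prv T (Neg p :: G) Bot -> prv T G p
| prv_allI G p : prv T (map nshift G) p -> prv T G (All p)
| prv_allE G p t : prv T G (All p) -> prv T G (inst t p)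
| prv_sallI G p : prv T (map sshift G) p -> prv T G (SAll p)
| prv_sallE G p Y : prv T G (SAll p) -> prv T G (sinst Y p)
| prv_refl G t : prv T G (Eq t t)
| prv_subst G p s t :
    prv T G (Eq s t) -> prv T G (inst s p) -> prv T G (inst t p).

Definition provable (T : form -> Prop) (p : form) : Prop := prv T nil p.

Definition extend (T A : form -> Prop) (p : form) : Prop := T p \/ A p.

Definition equivalent_over (T A B : form -> Prop) : Prop :=
  (forall p, B p -> provable (extend T A) p) /\
  (forall p, A p -> provable (extend T B) p).

(** * Writing formulas with named bound variables *)

(* [num], [svar] and [bform] are terms, set variables and formulas as functions
   of the number of enclosing quantifiers: a [num] of the enclosing number
   quantifiers, an [svar] of the enclosing set quantifiers, a [bform] of both
   (in this order). The variable bound under [d] quantifiers has de Bruijn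
   index [d' - S d] when it is used under [d'] of them. *)
Definition num : Type := nat -> term.
Definition svar : Type := nat -> nat.
Definition bform : Type := nat -> nat -> form.

Definition bzero : num := fun _ => TZero.
Definition bone : num := fun _ => TOne.
Definition badd (s t : num) : num := fun d => TAdd (s d) (t d).
Definition bmul (s t : num) : num := fun d => TMul (s d) (t d).
Definition beq (s t : num) : bform := fun d _ => Eq (s d) (t d).
Definition blt (s t : num) : bform := fun d _ => Lt (s d) (t d).
Definition bmem (t : num) (X : svar) : bform := fun d e => Mem (t d) (X e).
Definition bneg (p : bform) : bform := fun d e => Neg (p d e).
Definition bimp (p q : bform) : bform := fun d e => Imp (p d e) (q d e).
Definition band (p q : bform) : bform := fun d e => And (p d e) (q d e).
Definition bor (p q : bform) : bform := fun d e => Or (p d e) (q d e).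
Definition biff (p q : bform) : bform := fun d e => Iff (p d e) (q d e).
Definition bvar (d : nat) : num := fun d' => TVar (d' - S d).
Definition bsvar (e : nat) : svar := fun e' => e' - S e.
Definition ball (f : num -> bform) : bform :=
  fun d e => All (f (bvar d) (S d) e).
Definition bex (f : num -> bform) : bform :=
  fun d e => Ex (f (bvar d) (S d) e).
Definition bsall (f : svar -> bform) : bform :=
  fun d e => SAll (f (bsvar e) d (S e)).
Definition bsex (f : svar -> bform) : bform :=
  fun d e => SEx (f (bsvar e) d (S e)).
Definition sentence (p : bform) : form := p 0 0.

Declare Scope l2_scope.
Delimit Scope l2_scope with l2.
Local Notation "0" := bzero : l2_scope.
Local Notation "1" := bone : l2_scope.
Local Notation "s + t" := (badd s t) : l2_scope.
Local Notation "s * t" := (bmul s t) : l2_scope.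
Local Notation "s = t" := (beq s t) : l2_scope.
Local Notation "s < t" := (blt s t) : l2_scope.
Local Notation "s <= t" := (bor (blt s t) (beq s t)) : l2_scope.
Local Notation "t \in X" := (bmem t X) (at level 70) : l2_scope.
Local Notation "~ p" := (bneg p) : l2_scope.
Local Notation "p /\ q" := (band p q) : l2_scope.
Local Notation "p \/ q" := (bor p q) : l2_scope.
Local Notation "p ==> q" := (bimp p q)
  (at level 90, right associativity) : l2_scope.
Local Notation "p <-> q" := (biff p q) : l2_scope.
Local Notation "\A x .. y , p" := (ball (fun x => .. (ball (fun y => p)) ..))
  (at level 200, x binder, y binder, right associativity) : l2_scope.
Local Notation "\E x .. y , p" := (bex (fun x => .. (bex (fun y => p)) ..))
  (at level 200, x binder, y binder, right associativity) : l2_scope.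
Local Notation "\AS x .. y , p" := (bsall (fun x => .. (bsall (fun y => p)) ..))
  (at level 200, x binder, y binder, right associativity) : l2_scope.
Local Notation "\ES x .. y , p" := (bsex (fun x => .. (bsex (fun y => p)) ..))
  (at level 200, x binder, y binder, right associativity) : l2_scope.

(** * Axiom systems *)

Section BasicAxioms.
Local Open Scope l2_scope.

Definition basic_axioms : list form := map sentence
  (cons (\A n, ~ (n + 1 = 0))
  (cons (\A m n, m + 1 = n + 1 ==> m = n)
  (cons (\A m, m + 0 = m)
  (cons (\A m n, m + (n + 1) = (m + n) + 1)
  (cons (\A m, m * 0 = 0)
  (cons (\A m n, m * (n + 1) = (m * n) + m)
  (cons (\A m, ~ (m < 0))
  (cons (\A m n, m < n + 1 <-> m <= n) nil)))))))).

End BasicAxioms.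

(* Formulas all of whose quantifiers are bounded number quantifiers. The bound
   [t] does not contain the bound variable; bounded existential quantifiers
   are covered because [Ex] is defined from [All]. *)
Inductive bounded : form -> Prop :=
| bounded_Bot : bounded Bot
| bounded_Imp p q : bounded p -> bounded q -> bounded (Imp p q)
| bounded_Eq s t : bounded (Eq s t)
| bounded_Lt s t : bounded (Lt s t)
| bounded_Mem t X : bounded (Mem t X)
| bounded_All t p :
    bounded p -> bounded (All (Imp (Lt (TVar 0) (tshift t)) p)).

Definition sigma1 (p : form) : Prop := exists q, bounded q /\ p = Ex q.
Definition pi1 (p : form) : Prop := exists q, bounded q /\ p = All q.

Fixpoint arithmetical (p : form) : Prop :=
  match p with
  | Imp p1 p2 => arithmetical p1 /\ arithmetical p2
  | All p1 => arithmetical p1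
  | SAll _ => False
  | _ => True
  end.

(* In the schemas the distinguished number variable of [p] is the one with
   index 0; all other free variables of [p] are parameters. *)
Definition induction (p : form) : form :=
  let p_succ := fsubst (scons (TAdd (TVar 0) TOne) (fun n => TVar (S n)))
                       (fun n => n) p in
  Imp (And (inst TZero p) (All (Imp p p_succ))) (All p).

(* [sshift] ensures that the set asserted to exist is not free in [p]. *)
Definition comprehension (p : form) : form :=
  SEx (All (Iff (Mem (TVar 0) 0) (sshift p))).

Inductive RCA0 : form -> Prop :=
| RCA0_basic p : In p basic_axioms -> RCA0 p
| RCA0_induction p : sigma1 p -> RCA0 (induction p)
| RCA0_comprehension p q :
    sigma1 p -> pi1 q -> RCA0 (Imp (All (Iff p q)) (comprehension p)).

Inductive arithmetical_comprehension : form -> Prop :=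
| arithmetical_comprehension_intro p :
    arithmetical p -> arithmetical_comprehension (comprehension p).

(** * Rationals, reals and open sets in second-order arithmetic *)

Section Reals.
Local Open Scope l2_scope.

Definition pair (s t : num) : num := (s + t) * (s + t) + s.

(* The triple [Frac a b c] presents the rational (a - b) / (c + 1). *)
Record frac : Type := Frac { fpos : num; fneg : num; fden : num }.

Definition fall (F : frac -> bform) : bform := \A a b c, F (Frac a b c).
Definition fex (F : frac -> bform) : bform := \E a b c, F (Frac a b c).

Definition fzero : frac := Frac 0 0 0.
Definition fone : frac := Frac 1 0 0.
Definition fopp (f : frac) : frac := Frac (fneg f) (fpos f) (fden f).
Definition fadd (f g : frac) : frac :=
  Frac (fpos f * (fden g + 1) + fpos g * (fden f + 1))
       (fneg f * (fden g + 1) + fneg g * (fden f + 1))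
       (fden f * fden g + fden f + fden g).

Definition feq (f g : frac) : bform :=
  fpos f * (fden g + 1) + fneg g * (fden f + 1) =
  fpos g * (fden f + 1) + fneg f * (fden g + 1).
Definition flt (f g : frac) : bform :=
  fpos f * (fden g + 1) + fneg g * (fden f + 1) <
  fpos g * (fden f + 1) + fneg f * (fden g + 1).

Definition fcode (f : frac) : num := pair (pair (fpos f) (fneg f)) (fden f).

(* Rationals are represented uniquely: a number is a rational if it is the
   least code of a triple presenting it, so equality of rationals is equality
   of numbers. [is_rat q f] says that q represents the rational given by f. *)
Definition is_rat (q : num) (f : frac) : bform :=
  fex (fun g => feq g f /\ q = fcode g) /\
  fall (fun g => feq g f ==> q <= fcode g).

Definition rat (q : num) : bform := fex (fun f => is_rat q f).
Definition rat_pos (q : num) : bform :=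
  fex (fun f => is_rat q f /\ flt fzero f).
Definition rat_lt (p q : num) : bform :=
  fex (fun f => fex (fun g => is_rat p f /\ is_rat q g /\ flt f g)).
Definition rat_le (p q : num) : bform := rat_lt p q \/ p = q.

(* Graphs of the rational operations: s = p + q, s = p - q and s = |p|. *)
Definition rat_add (p q s : num) : bform :=
  fex (fun f => fex (fun g =>
    is_rat p f /\ is_rat q g /\ is_rat s (fadd f g))).
Definition rat_sub (p q s : num) : bform :=
  fex (fun f => fex (fun g =>
    is_rat p f /\ is_rat q g /\ is_rat s (fadd f (fopp g)))).
Definition rat_abs (p s : num) : bform :=
  fex (fun f => is_rat p f /\
    ((flt f fzero /\ is_rat s (fopp f)) \/ (~ flt f fzero /\ is_rat s f))).

(* Sequences of rationals, given by their graphs: [x n q] says x_n = q. They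
   are sets of pairs, constant sequences, or obtained by pointwise operations. *)
Definition ratseq : Type := num -> num -> bform.
Definition seq_set (X : svar) : ratseq := fun n q => pair n q \in X.
Definition seq_rat (a : num) : ratseq := fun _ q => q = a.
Definition seq_frac (f : frac) : ratseq := fun _ q => is_rat q f.
Definition seq_add (x y : ratseq) : ratseq :=
  fun n s => \E p q, x n p /\ y n q /\ rat_add p q s.
Definition seq_sub (x y : ratseq) : ratseq :=
  fun n s => \E p q, x n p /\ y n q /\ rat_sub p q s.
Definition seq_abs (x : ratseq) : ratseq :=
  fun n s => \E p, x n p /\ rat_abs p s.

Definition real_le (x y : ratseq) : bform :=
  \A eps, rat_pos eps ==> \E N, \A n, N <= n ==>
    \A p q, x n p ==> seq_add y (seq_rat eps) n q ==> rat_le p q.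
Definition real_eq (x y : ratseq) : bform := real_le x y /\ real_le y x.
Definition real_lt (x y : ratseq) : bform := real_le x y /\ ~ real_eq x y.

(* X is (the graph of) a function from the natural numbers to C. *)
Definition function_to (C : num -> bform) (X : svar) : bform :=
  (\A k, k \in X ==> \E n q, k = pair n q /\ C q) /\
  (\A n, \E q, pair n q \in X /\ \A q', pair n q' \in X ==> q' = q).

Definition real (X : svar) : bform :=
  function_to rat X /\
  \A eps, rat_pos eps ==> \E N, \A m n, N <= m ==> N <= n ==>
    \A p q s t, pair m p \in X ==> pair n q \in X ==>
      rat_sub p q s ==> rat_abs s t ==> rat_lt t eps.

Definition in_unit_interval (X : svar) : bform :=
  real X /\ real_le (seq_frac fzero) (seq_set X) /\
  real_le (seq_set X) (seq_frac fone).

(* X lies in the ball with rational centre a and rational radius r. *)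
Definition in_ball (X : svar) (a r : num) : bform :=
  real_lt (seq_abs (seq_sub (seq_rat a) (seq_set X))) (seq_rat r).

(* The set U codes the family of the codes
   U_{ni} = {(m,a,r) | ((n,i),(m,(a,r))) in U}. *)
Definition family_elt (n i m a r : num) : num :=
  pair (pair n i) (pair m (pair a r)).

Definition open_family (U : svar) : bform :=
  \A k, k \in U ==>
    \E n i m a r, k = family_elt n i m a r /\ rat a /\ rat_pos r.

Definition in_open (X U : svar) (n i : num) : bform :=
  \E N a r, rat a /\ rat_pos r /\ in_ball X a r /\
    \A m, N <= m ==> family_elt n i m a r \in U.

Definition uniform_heine_borel : form := sentence
  (\AS U, open_family U ==>
    (\A n, \AS X, in_unit_interval X ==> \E i, in_open X U n i) ==>
    \ES H, function_to (fun k => k = k) H /\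
      \A n k, pair n k \in H ==>
        \AS X, in_unit_interval X ==> \E i, i <= k /\ in_open X U n i).

End Reals.

(* Main.v *)
(* Both implications are proved semantically: by the completeness theorem for
   [prv] it suffices to compare the two principles in every countable Henkin
   model of RCA_0, whose rationals form an ordered field.

   Covers to comprehension: given a bounded [phi], let [U_ni] contain the ball
   of radius 2 around 0, listed at the stages [m] such that [phi n y] holds for
   some [y <= i] or for no [y <= m]. As membership asks for all large [m],
   [U_ni] contains [0,1] if some [y <= i] satisfies [phi n y] or no [y] does,
   and is empty otherwise; so the [U_ni] cover [0,1] and [h n] bounds a witness
   of [exists y, phi n y] if there is one. This yields Sigma^0_1 comprehension,
   and then every arithmetical formula is equivalent to a bounded one with set
   parameters.

   Comprehension to covers: say that [q] is good if some [i <= k] and some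
   Lebesgue number work for all rational points of [0,q[. This is arithmetical.
   If 1 were not good, the supremum of the good [q] would be a real of [0,1],
   approximated by the grid points of mesh 1/(m+1) that lie below it, and a ball
   around it would contain a good point that exceeds it. *)

From Corelib Require Import ssreflect ssrfun ssrbool.
From Stdlib Require Import List Arith Lia Cantor Ring.
From Stdlib Require Import Classical ClassicalEpsilon.
From Stdlib Require Import FunctionalExtensionality PropExtensionality.
Require Import Defs.
Import ListNotations.

(** * Substitution *)

(** The numbers of a countable model may be nonstandard, so induction and finiteness in the sense of
    the metatheory say nothing about them: induction, least elements and set formation are available
    only for predicates given by formulas, and each use carries a proof of [Def]. This is why
    quantifiers are kept bounded where possible and why tuples are coded so that the code bounds its
    components. In return the rationals of the model form a genuine ordered field, where
    inequalities are settled by [lra]; this field is Archimedean only with respect to the numbers of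
    the model.

    No compactness is at stake in the reversal. Its strength comes from the limit condition in the
    codes of open sets, which lets a bounded [U] express a disjunction of a Sigma-1 and a Pi-1
    condition, and from a single [h] that bounds infinitely many covers at once. *)

Definition up (s : nat -> term) : nat -> term :=
  scons (TVar 0) (fun n => tshift (s n)).
Definition upr (r : nat -> nat) : nat -> nat := scons 0 (fun n => S (r n)).

Lemma tsubst_comp s s' t :
  tsubst s' (tsubst s t) = tsubst (fun n => tsubst s' (s n)) t.
Proof. by elim: t => //= t1 -> t2 ->. Qed.

Lemma tsubst_id t : tsubst TVar t = t.
Proof. by elim: t => //= t1 -> t2 ->. Qed.

Lemma up_comp s s' : (fun n => tsubst (up s') (up s n)) = up (fun n => tsubst s' (s n)).
Proof.
apply: functional_extensionality => -[|n] //=.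
by rewrite /tshift !tsubst_comp.
Qed.

Lemma upr_comp r r' : (fun n => upr r' (upr r n)) = upr (fun n => r' (r n)).
Proof. by apply: functional_extensionality => -[|n]. Qed.

Lemma up_id : up TVar = TVar.
Proof. by apply: functional_extensionality => -[|n]. Qed.

Lemma upr_id : upr (fun n => n) = (fun n => n).
Proof. by apply: functional_extensionality => -[|n]. Qed.

Lemma fsubst_comp p s r s' r' :
  fsubst s' r' (fsubst s r p)
  = fsubst (fun n => tsubst s' (s n)) (fun n => r' (r n)) p.
Proof.
elim: p s r s' r' => //=.
- by move=> p IHp q IHq s r s' r'; rewrite IHp IHq.
- by move=> t u s r s' r'; rewrite !tsubst_comp.
- by move=> t u s r s' r'; rewrite !tsubst_comp.
- by move=> t X s r s' r'; rewrite !tsubst_comp.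
- by move=> p IHp s r s' r'; rewrite IHp -/(up s) -/(up s') up_comp.
- by move=> p IHp s r s' r'; rewrite IHp -/(upr r) -/(upr r') upr_comp.
Qed.

Lemma fsubst_id p : fsubst TVar (fun n => n) p = p.
Proof.
elim: p => //=.
- by move=> p -> q ->.
- by move=> t u; rewrite !tsubst_id.
- by move=> t u; rewrite !tsubst_id.
- by move=> t X; rewrite !tsubst_id.
- by move=> p IHp; rewrite -/(up TVar) up_id IHp.
- by move=> p IHp; rewrite -/(upr (fun n => n)) upr_id IHp.
Qed.

Lemma fsubst_inst s r t p :
  fsubst s r (inst t p) = inst (tsubst s t) (fsubst (up s) r p).
Proof.
rewrite /inst !fsubst_comp; congr fsubst.
apply: functional_extensionality => -[|n] //=.
by rewrite /tshift tsubst_comp tsubst_id.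
Qed.

Lemma fsubst_sinst s r Y p :
  fsubst s r (sinst Y p) = sinst (r Y) (fsubst s (upr r) p).
Proof.
rewrite /sinst !fsubst_comp; congr fsubst.
- by apply: functional_extensionality => n /=; rewrite tsubst_id.
- by apply: functional_extensionality => -[|n].
Qed.

Lemma inst_up t s r p : inst t (fsubst (up s) r p) = fsubst (scons t s) r p.
Proof.
rewrite /inst fsubst_comp; congr fsubst.
apply: functional_extensionality => -[|n] //=.
by rewrite /tshift tsubst_comp tsubst_id.
Qed.

Lemma sinst_upr Y s r p : sinst Y (fsubst s (upr r) p) = fsubst s (scons Y r) p.
Proof.
rewrite /sinst fsubst_comp; congr fsubst.
- by apply: functional_extensionality => n /=; rewrite tsubst_id.
- by apply: functional_extensionality => -[|n].
Qed.

Lemma nshift_fsubst s r p : fsubst (up s) r (nshift p) = nshift (fsubst s r p).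
Proof. by rewrite /nshift !fsubst_comp. Qed.

Lemma sshift_fsubst s r p : fsubst s (upr r) (sshift p) = sshift (fsubst s r p).
Proof.
rewrite /sshift !fsubst_comp; congr fsubst.
by apply: functional_extensionality => n /=; rewrite tsubst_id.
Qed.

Lemma term_support t : exists N, forall s s',
  (forall n, n < N -> s n = s' n) -> tsubst s t = tsubst s' t.
Proof.
elim: t => [n|||t [N IHt] u [K IHu]|t [N IHt] u [K IHu]] /=; try by exists 0.
- by exists (S n) => s s' e; apply: e; lia.
- by exists (max N K) => s s' e; rewrite (IHt s s') ?(IHu s s') //; move=> n h; apply: e; lia.
- by exists (max N K) => s s' e; rewrite (IHt s s') ?(IHu s s') //; move=> n h; apply: e; lia.
Qed.

(** Expresses that all free indices of [p], of both sorts, lie below [N]. It serves as the notion of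
    freshness: every index from [N] on is an eigenvariable for [p]. *)
Definition supported N p := forall s s' r r',
  (forall n, n < N -> s n = s' n) -> (forall n, n < N -> r n = r' n) ->
  fsubst s r p = fsubst s' r' p.

Lemma supported_le N K p : N <= K -> supported N p -> supported K p.
Proof. by move=> le H s s' r r' e e'; apply: H => n h; [apply: e|apply: e']; lia. Qed.

Lemma form_support p : exists N, supported N p.
Proof.
elim: p => /=.
- by exists 0.
- move=> p [N IHp] q [K IHq]; exists (max N K) => s s' r r' e e' /=.
  congr Imp; [apply: IHp|apply: IHq] => n h; (apply: e || apply: e'); lia.
- move=> t u; have [N Ht] := term_support t; have [K Hu] := term_support u.
  exists (max N K) => s s' r r' e e' /=.
  congr Eq; [apply: Ht|apply: Hu] => n h; apply: e; lia.
- move=> t u; have [N Ht] := term_support t; have [K Hu] := term_support u.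
  exists (max N K) => s s' r r' e e' /=.
  congr Lt; [apply: Ht|apply: Hu] => n h; apply: e; lia.
- move=> t X; have [N Ht] := term_support t.
  exists (max N (S X)) => s s' r r' e e' /=.
  congr Mem; [apply: Ht => n h; apply: e|apply: e']; lia.
- move=> p [N IHp]; exists N => s s' r r' e e' /=.
  congr All; apply: IHp => // -[|n] h //=.
  by rewrite e //; lia.
- move=> p [N IHp]; exists N => s s' r r' e e' /=.
  congr SAll; apply: IHp => // -[|n] h //=.
  by rewrite e' //; lia.
Qed.

Lemma forms_support G : exists N, forall p, In p G -> supported N p.
Proof.
elim: G => [|p G [N IH]]; first by exists 0.
have [K Hp] := form_support p; exists (max N K) => q /= [<-|/IH H].
- by apply: supported_le Hp; lia.
- by apply: supported_le H; lia.
Qed.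

(** * Derivations *)

Lemma prv_weak T G G' p : prv T G p -> incl G G' -> prv T G' p.
Proof.
move=> H; elim: H G' => {G p}.
- by move=> G p Tp G' _; apply: prv_ax.
- by move=> G p Gp G' i; apply: prv_hyp; apply: i.
- move=> G p q _ IH G' i; apply: prv_impI; apply: IH => x /= [->|/i]; [by left|by right].
- by move=> G p q _ IH1 _ IH2 G' i; apply: prv_impE (IH1 _ i) (IH2 _ i).
- move=> G p _ IH G' i; apply: prv_raa; apply: IH => x /= [->|/i]; [by left|by right].
- by move=> G p _ IH G' i; apply: prv_allI; apply: IH; apply: incl_map.
- by move=> G p t _ IH G' i; apply: prv_allE; apply: IH.
- by move=> G p _ IH G' i; apply: prv_sallI; apply: IH; apply: incl_map.
- by move=> G p t _ IH G' i; apply: prv_sallE; apply: IH.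
- by move=> G t G' i; apply: prv_refl.
- by move=> G p s t _ IH1 _ IH2 G' i; apply: prv_subst (IH1 _ i) (IH2 _ i).
Qed.

(** [prv_ax] inserts members of [T] as they stand, so a substitution can be pushed through a
    derivation only if it carries axioms to axioms. *)
Definition subst_closed (T : form -> Prop) :=
  forall p s r, T p -> T (fsubst s r p).

Lemma prv_fsubst T G p s r : subst_closed T ->
  prv T G p -> prv T (map (fsubst s r) G) (fsubst s r p).
Proof.
move=> cT H; elim: H s r => {G p} /=.
- by move=> G p Tp s r; apply: prv_ax; apply: cT.
- by move=> G p Gp s r; apply: prv_hyp; apply: in_map.
- by move=> G p q _ IH s r; apply: prv_impI; apply: IH.
- by move=> G p q _ IH1 _ IH2 s r; apply: prv_impE (IH1 _ _) (IH2 _ _).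
- by move=> G p _ IH s r; apply: prv_raa; apply: IH.
- move=> G p _ IH s r; apply: prv_allI; move: (IH (up s) r).
  by rewrite !map_map (map_ext _ _ (nshift_fsubst s r)).
- by move=> G p t _ IH s r; rewrite fsubst_inst; apply: prv_allE; apply: IH.
- move=> G p _ IH s r; apply: prv_sallI; move: (IH s (upr r)).
  by rewrite !map_map (map_ext _ _ (sshift_fsubst s r)).
- by move=> G p t _ IH s r; rewrite fsubst_sinst; apply: prv_sallE; apply: IH.
- by move=> G t s r; apply: prv_refl.
- move=> G p t u _ IH1 _ IH2 s r; rewrite fsubst_inst; apply: prv_subst (IH1 _ _) _.
  by rewrite -fsubst_inst.
Qed.

Lemma prv_generalize T G q x : subst_closed T ->
  (forall p, In p G -> supported x p) -> supported x q ->
  prv T G (inst (TVar x) q) -> prv T G (All q).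
Proof.
move=> cT sG sq H.
(* [f] sends the eigenvariable to the variable about to be bound and shifts the others; on formulas
   supported below [x] it coincides with [nshift]. *)
pose f n := if Nat.eqb n x then TVar 0 else TVar (S n).
have fS n : n < x -> f n = TVar (S n).
  by move=> h; rewrite /f; case: Nat.eqb_spec => // e; lia.
apply: prv_allI; have := prv_fsubst T G _ f (fun n => n) cT H.
have -> : map (fsubst f (fun n => n)) G = map nshift G.
  by apply: map_ext_in => p /sG s; apply: s => // n /fS.
rewrite /inst fsubst_comp.
have -> // : fsubst (fun n => tsubst f (scons (TVar x) TVar n)) (fun n => n) q = q.
rewrite -[RHS]fsubst_id; apply: sq => // -[|n] h /=.
- by rewrite /f Nat.eqb_refl.
- by rewrite fS //; lia.
Qed.

Lemma prv_sgeneralize T G q x : subst_closed T ->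
  (forall p, In p G -> supported x p) -> supported x q ->
  prv T G (sinst x q) -> prv T G (SAll q).
Proof.
move=> cT sG sq H.
pose f n := if Nat.eqb n x then 0 else S n.
have fS n : n < x -> f n = S n.
  by move=> h; rewrite /f; case: Nat.eqb_spec => // e; lia.
apply: prv_sallI; have := prv_fsubst T G _ TVar f cT H.
have -> : map (fsubst TVar f) G = map sshift G.
  by apply: map_ext_in => p /sG s; apply: s => // n /fS.
rewrite /sinst fsubst_comp.
have -> // : fsubst (fun n => tsubst TVar (TVar n)) (fun n => f (scons x (fun m => m) n)) q = q.
rewrite -[RHS]fsubst_id; apply: sq => // -[|n] h /=.
- by rewrite /f Nat.eqb_refl.
- by rewrite fS //; lia.
Qed.

Fixpoint alls (n : nat) (p : form) : form :=
  match n with O => p | S n => All (alls n p) end.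
Fixpoint salls (n : nat) (p : form) : form :=
  match n with O => p | S n => SAll (salls n p) end.
(** Prepends the first [n] values of [f] to [s], starting with the last of them, because the
    outermost quantifier of [alls n p] is eliminated first and binds the index [n - 1] of [p]. *)
Fixpoint rscons {A : Type} (n : nat) (f s : nat -> A) : nat -> A :=
  match n with O => s | S n => rscons n f (scons (f n) s) end.

Lemma rscons_lt {A} n (f s : nat -> A) k : k < n -> rscons n f s k = f k.
Proof.
have H m : forall s', rscons m f s' = fun k => if Nat.ltb k m then f k else s' (k - m).
{ elim: m => [|m IH] s'; apply: functional_extensionality => j /=.
    by rewrite Nat.sub_0_r.
  have -> : Nat.ltb j (S m) = Nat.leb j m by [].
  rewrite IH; case: (Nat.ltb_spec j m) => h1; case: (Nat.leb_spec j m) => h2 //; try lia.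
  - have -> : j = m by lia.
    by rewrite Nat.sub_diag.
  - by have -> : j - m = S (j - S m) by lia. }
by rewrite H => h; case: Nat.ltb_spec => // h'; lia.
Qed.

Lemma prv_alls_elim T G n p s r f :
  prv T G (fsubst s r (alls n p)) -> prv T G (fsubst (rscons n f s) r p).
Proof.
elim: n s => //= n IH s H; apply: IH.
by rewrite -inst_up; apply: prv_allE.
Qed.

Lemma prv_salls_elim T G n p s r f :
  prv T G (fsubst s r (salls n p)) -> prv T G (fsubst s (rscons n f r) p).
Proof.
elim: n r => //= n IH r H; apply: IH.
by rewrite -sinst_upr; apply: prv_sallE.
Qed.

(** Only finitely many values of a substitution matter for [p]. An axiom is available in every
    context, so it can be generalized over these variables of both sorts, and eliminating the
    quantifiers yields the instance. *)
Lemma prv_ax_fsubst (T : form -> Prop) G p s r : T p -> prv T G (fsubst s r p).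
Proof.
move=> Tp; have [N sN] := form_support p.
have -> : fsubst s r p = fsubst (rscons N s TVar) (rscons N r (fun n => n)) p.
  by apply: sN => n h; rewrite rscons_lt.
apply: prv_alls_elim.
have H n G' : prv T G' (alls n p).
  by elim: n G' => [|n IH] G' /=; [apply: prv_ax|apply: prv_allI].
have H' n G' : prv T G' (salls n (alls N p)).
  by elim: n G' => [|n IH] G' /=; [apply: H|apply: prv_sallI].
by apply: prv_salls_elim; rewrite fsubst_id.
Qed.

(** This theory proves nothing more than [T] does, so the Henkin construction may work with a
    substitution-closed theory although [T] is arbitrary. *)
Definition subst_closure (T : form -> Prop) (p : form) : Prop :=
  exists q s r, T q /\ p = fsubst s r q.

Lemma subst_closure_closed T : subst_closed (subst_closure T).
Proof.
move=> _ s r [q [s' [r' [Tq ->]]]].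
by exists q, (fun n => tsubst s (s' n)), (fun n => r (r' n)); rewrite fsubst_comp.
Qed.

Lemma prv_subst_closure T G p : prv (subst_closure T) G p -> prv T G p.
Proof.
elim=> {G p}.
- by move=> G p [q [s [r [Tq ->]]]]; apply: prv_ax_fsubst.
- by move=> *; apply: prv_hyp.
- by move=> *; apply: prv_impI.
- by move=> G p q _ H _; apply: prv_impE H.
- by move=> *; apply: prv_raa.
- by move=> *; apply: prv_allI.
- by move=> *; apply: prv_allE.
- by move=> *; apply: prv_sallI.
- by move=> *; apply: prv_sallE.
- by move=> *; apply: prv_refl.
- by move=> G p s t _ H _; apply: prv_subst H.
Qed.

(** * Completeness *)

Fixpoint tcode (t : term) : nat :=
  match t with
  | TVar n => to_nat (0, n)
  | TZero => to_nat (1, 0)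
  | TOne => to_nat (2, 0)
  | TAdd t u => to_nat (3, to_nat (tcode t, tcode u))
  | TMul t u => to_nat (4, to_nat (tcode t, tcode u))
  end.

Fixpoint code (p : form) : nat :=
  match p with
  | Bot => to_nat (0, 0)
  | Imp p q => to_nat (1, to_nat (code p, code q))
  | Eq t u => to_nat (2, to_nat (tcode t, tcode u))
  | Lt t u => to_nat (3, to_nat (tcode t, tcode u))
  | Mem t X => to_nat (4, to_nat (tcode t, X))
  | All p => to_nat (5, code p)
  | SAll p => to_nat (6, code p)
  end.

Lemma to_nat_pair a b a' b' : to_nat (a, b) = to_nat (a', b') -> a = a' /\ b = b'.
Proof. by move=> e; have [-> ->] := to_nat_inj _ _ e. Qed.

Lemma tcode_inj t u : tcode t = tcode u -> t = u.
Proof.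
elim: t u => [n|||t1 IH1 t2 IH2|t1 IH1 t2 IH2] [m|||u1 u2|u1 u2];
  move=> e; have {e} [// _ e] := to_nat_pair _ _ _ _ e; rewrite -/tcode in e.
- by rewrite e.
- by move: e => /to_nat_pair [/IH1 -> /IH2 ->].
- by move: e => /to_nat_pair [/IH1 -> /IH2 ->].
Qed.

Lemma code_inj p q : code p = code q -> p = q.
Proof.
elim: p q => [|p1 IH1 p2 IH2|t1 t2|t1 t2|t X|p IH|p IH] [|q1 q2|u1 u2|u1 u2|u Y|q|q];
  move=> e; have {e} [// _ e] := to_nat_pair _ _ _ _ e; rewrite -/code -/tcode in e.
- by move: e => /to_nat_pair [/IH1 -> /IH2 ->].
- by move: e => /to_nat_pair [/tcode_inj -> /tcode_inj ->].
- by move: e => /to_nat_pair [/tcode_inj -> /tcode_inj ->].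
- by move: e => /to_nat_pair [/tcode_inj -> ->].
- by rewrite (IH _ e).
- by rewrite (IH _ e).
Qed.

(** A number that codes no formula gets an arbitrary one; this is harmless, since the construction
    only has to visit every formula. *)
Definition enum (n : nat) : form := epsilon (inhabits Bot) (fun p => code p = n).

Lemma enum_code p : enum (code p) = p.
Proof.
apply: code_inj; apply: (epsilon_spec (inhabits Bot) (fun q => code q = code p)).
by exists p.
Qed.

Record model : Type := Model {
  carrier :> Type;
  mzero : carrier;
  mone : carrier;
  madd : carrier -> carrier -> carrier;
  mmul : carrier -> carrier -> carrier;
  mlt : carrier -> carrier -> Prop;
  mmem : carrier -> nat -> Prop }.

Fixpoint eval (M : model) (s : nat -> M) (t : term) : M :=
  match t with
  | TVar n => s n
  | TZero => mzero M
  | TOne => mone M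
  | TAdd t u => madd M (eval M s t) (eval M s u)
  | TMul t u => mmul M (eval M s t) (eval M s u)
  end.

Fixpoint sat (M : model) (s : nat -> M) (r : nat -> nat) (p : form) : Prop :=
  match p with
  | Bot => False
  | Imp p q => sat M s r p -> sat M s r q
  | Eq t u => eval M s t = eval M s u
  | Lt t u => mlt M (eval M s t) (eval M s u)
  | Mem t X => mmem M (eval M s t) (r X)
  | All p => forall x, sat M (scons x s) r p
  | SAll p => forall Y, sat M s (scons Y r) p
  end.

(** * Maximal consistent extension with witnesses *)

Section Henkin.
Variables (T : form -> Prop) (phi : form).
Hypotheses (cT : subst_closed T) (nphi : ~ prv T nil phi).

Definition consistent (G : list form) : Prop := ~ prv T G Bot.

(** Variables take the place of Henkin constants. Stages are finite lists, so a variable fresh for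
    the whole stage always exists. *)
Record good_step (n : nat) (G G' : list form) : Prop := {
  step_consistent : consistent G';
  step_incl : incl G G';
  step_decide : In (enum n) G' \/ ~ consistent (enum n :: G);
  step_witness q : enum n = Neg (All q) -> In (enum n) G' ->
    exists x, In (Neg (inst (TVar x) q)) G';
  step_switness q : enum n = Neg (SAll q) -> In (enum n) G' ->
    exists x, In (Neg (sinst x q)) G' }.

Lemma step_exists n G : consistent G -> exists G', good_step n G G'.
Proof.
move=> cG; case: (classic (consistent (enum n :: G))) => cn; last first.
  have nin : ~ In (enum n) G.
    move=> i; apply: cn => H; apply: cG; apply: prv_weak H _.
    by move=> x [<-|].
  by exists G; split=> //; right.
case: (classic (exists q, enum n = Neg (All q))) => [[q eq]|nall].
{ have [x sx] := forms_support (q :: enum n :: G).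
  exists (Neg (inst (TVar x) q) :: enum n :: G); split.
  (* An inconsistency caused by the witness would prove the instance of [q] at the fresh [x], hence
     [All q], against [enum n]. *)
  - move=> H; apply: (cn); apply: (prv_impE _ _ (All q)).
      by apply: prv_hyp; rewrite eq; left.
    apply: (prv_generalize _ _ _ x cT).
    + by move=> p i; apply: sx; right.
    + by apply: sx; left.
    + exact: prv_raa H.
  - by move=> y i; right; right.
  - by left; right; left.
  - move=> q' e _; exists x; left.
    by move: e; rewrite eq => -[->].
  - by move=> q'; rewrite eq. }
case: (classic (exists q, enum n = Neg (SAll q))) => [[q eq]|nsall].
{ have [x sx] := forms_support (q :: enum n :: G).
  exists (Neg (sinst x q) :: enum n :: G); split.
  - move=> H; apply: (cn); apply: (prv_impE _ _ (SAll q)).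
      by apply: prv_hyp; rewrite eq; left.
    apply: (prv_sgeneralize _ _ _ x cT).
    + by move=> p i; apply: sx; right.
    + by apply: sx; left.
    + exact: prv_raa H.
  - by move=> y i; right; right.
  - by left; right; left.
  - by move=> q'; rewrite eq.
  - move=> q' e _; exists x; left.
    by move: e; rewrite eq => -[->]. }
exists (enum n :: G); split=> //.
- by move=> y i; right.
- by left; left.
- by move=> q e; case: nall; exists q.
- by move=> q e; case: nsall; exists q.
Qed.

Definition next (n : nat) (G : {G | consistent G}) : {G | consistent G} :=
  let G' := constructive_indefinite_description _ (step_exists n _ (proj2_sig G)) in
  exist _ (proj1_sig G') (step_consistent _ _ _ (proj2_sig G')).

Lemma start_consistent : consistent [Neg phi].
Proof. by move=> H; apply: nphi; apply: prv_raa. Qed.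

Fixpoint chain (n : nat) : {G | consistent G} :=
  match n with
  | O => exist _ [Neg phi] start_consistent
  | S n => next n (chain n)
  end.

Definition stage (n : nat) : list form := proj1_sig (chain n).

Lemma stage_step n : good_step n (stage n) (stage (S n)).
Proof. by rewrite /stage /= /next; case: constructive_indefinite_description. Qed.

Lemma stage_consistent n : consistent (stage n).
Proof. exact: (proj2_sig (chain n)). Qed.

Lemma stage_incl n m : n <= m -> incl (stage n) (stage m).
Proof.
elim=> [|k _ IH]; first exact: incl_refl.
exact: incl_tran IH (step_incl _ _ _ (stage_step k)).
Qed.

Definition holds (p : form) : Prop := exists n, In p (stage n).

(** The formula [p] is decided at the step given by its own code. Had it been rejected there, a
    later stage would derive both [p] and its negation. *)
Lemma holds_prv n p : prv T (stage n) p -> holds p.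
Proof.
move=> H; exists (S (code p)).
case: (step_decide _ _ _ (stage_step (code p))); rewrite enum_code // => nc.
case: nc => H'; apply: (stage_consistent (max n (code p))).
apply: (prv_impE _ _ p).
- apply: prv_weak (prv_impI _ _ _ _ H') _; apply: stage_incl; lia.
- apply: prv_weak H _; apply: stage_incl; lia.
Qed.

Lemma holds_axiom p s r : T p -> holds (fsubst s r p).
Proof. by move=> Tp; apply: (holds_prv 0); apply: prv_ax; apply: cT. Qed.

Lemma prv_holds p : holds p -> exists n, forall m, n <= m -> prv T (stage m) p.
Proof. by case=> n i; exists n => m le; apply: prv_hyp; apply: stage_incl i. Qed.

Lemma holds_rule0 p : (forall G, prv T G p) -> holds p.
Proof. by move=> H; apply: (holds_prv 0). Qed.

Lemma holds_rule1 p q : (forall G, prv T G p -> prv T G q) -> holds p -> holds q.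
Proof. by move=> H /prv_holds [n Hn]; apply: (holds_prv n); apply: H; apply: Hn. Qed.

Lemma holds_rule2 p q p' : (forall G, prv T G p -> prv T G q -> prv T G p') ->
  holds p -> holds q -> holds p'.
Proof.
move=> H /prv_holds [n Hn] /prv_holds [m Hm]; apply: (holds_prv (max n m)).
by apply: H; [apply: Hn|apply: Hm]; lia.
Qed.

Lemma holds_Bot : ~ holds Bot.
Proof. by case=> n i; apply: (stage_consistent n); apply: prv_hyp. Qed.

Lemma holds_or_neg p : holds p \/ holds (Neg p).
Proof.
case: (step_decide _ _ _ (stage_step (code p))); rewrite enum_code => H.
  by left; exists (S (code p)).
right; apply: (holds_prv (code p)); apply: prv_impI.
exact: NNPP.
Qed.

Lemma holds_Imp p q : holds (Imp p q) <-> (holds p -> holds q).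
Proof.
split; first by apply: holds_rule2 => G; apply: prv_impE.
case: (holds_or_neg p) => [hp /(_ hp)|np _].
  by apply: holds_rule1 => G H; apply: prv_impI; apply: prv_weak H _; right.
apply: holds_rule1 np => G H; apply: prv_impI; apply: prv_raa.
apply: (prv_impE _ _ p); last by apply: prv_hyp; right; left.
by apply: prv_weak H _ => x i; right; right.
Qed.

Lemma holds_Neg p : holds (Neg p) -> ~ holds p.
Proof. by move=> /holds_Imp H /H /holds_Bot. Qed.

(** If [All p] fails, its negation holds and was added at the step of its own code together with a
    refuted instance. *)
Lemma holds_All p : holds (All p) <-> forall t, holds (inst t p).
Proof.
split; first by move=> H t; apply: holds_rule1 H => G; apply: prv_allE.
move=> H; case: (holds_or_neg (All p)) => // np.
have [n i] := np; have st := stage_step (code (Neg (All p))).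
case: (step_decide _ _ _ st); rewrite enum_code => H'.
  have [||x ix] := step_witness _ _ _ st p; rewrite ?enum_code //.
  by case: (holds_Neg (inst (TVar x) p)); [exists (S (code (Neg (All p))))|].
(* Rejection is impossible, because [Neg (All p)] belongs to stage [n] and a common later stage
   would be inconsistent. *)
case: H' => H'; apply: (stage_consistent (max n (code (Neg (All p))))).
apply: prv_weak H' _ => x [<-|].
- by apply: stage_incl i; lia.
- by apply: (stage_incl _ _ (Nat.le_max_r _ _)).
Qed.

Lemma holds_SAll p : holds (SAll p) <-> forall Y, holds (sinst Y p).
Proof.
split; first by move=> H t; apply: holds_rule1 H => G; apply: prv_sallE.
move=> H; case: (holds_or_neg (SAll p)) => // np.
have [n i] := np; have st := stage_step (code (Neg (SAll p))).
case: (step_decide _ _ _ st); rewrite enum_code => H'.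
  have [||x ix] := step_switness _ _ _ st p; rewrite ?enum_code //.
  by case: (holds_Neg (sinst x p)); [exists (S (code (Neg (SAll p))))|].
case: H' => H'; apply: (stage_consistent (max n (code (Neg (SAll p))))).
apply: prv_weak H' _ => x [<-|].
- by apply: stage_incl i; lia.
- by apply: (stage_incl _ _ (Nat.le_max_r _ _)).
Qed.

(** * The term model *)

Definition eqv (t u : term) : Prop := holds (Eq t u).

Lemma eqv_refl t : eqv t t.
Proof. by apply: holds_rule0 => G; apply: prv_refl. Qed.

Lemma inst_shift t u : tsubst (scons u TVar) (tshift t) = t.
Proof. by rewrite /tshift tsubst_comp tsubst_id. Qed.

Lemma eqv_subst p t u : eqv t u -> holds (inst t p) -> holds (inst u p).
Proof. by apply: holds_rule2 => G; apply: prv_subst. Qed.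

Lemma eqv_sym t u : eqv t u -> eqv u t.
Proof.
move=> e; have := eqv_subst (Eq (TVar 0) (tshift t)) _ _ e.
by rewrite /inst /= !inst_shift; apply; apply: eqv_refl.
Qed.

Lemma eqv_trans t u v : eqv t u -> eqv u v -> eqv t v.
Proof.
move=> e e'; have := eqv_subst (Eq (tshift t) (TVar 0)) _ _ e'.
by rewrite /inst /= !inst_shift; apply.
Qed.

(** [sat] reads [Eq] as equality of the carrier, so provably equal terms must become one element;
    this is done by choosing a representative in each class. *)
Definition repr (t : term) : term := epsilon (inhabits t) (eqv t).

Lemma repr_eqv t : eqv t (repr t).
Proof. by apply: epsilon_spec; exists t; apply: eqv_refl. Qed.

Lemma repr_eq t u : repr t = repr u <-> eqv t u.
Proof.
split=> [e|e].
  by apply: eqv_trans (repr_eqv t) _; rewrite e; apply: eqv_sym; apply: repr_eqv.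
have -> : repr t = epsilon (inhabits u) (eqv t).
  by rewrite /repr; congr epsilon; apply: proof_irrelevance.
congr epsilon; apply: functional_extensionality => v; apply: propositional_extensionality.
by split; [apply: eqv_trans; apply: eqv_sym|apply: eqv_trans].
Qed.

Definition tclass : Type := {t | repr t = t}.

Lemma tclass_eq (d e : tclass) : proj1_sig d = proj1_sig e -> d = e.
Proof.
case: d e => [t ht] [u hu] /= e; subst u.
by congr exist; apply: proof_irrelevance.
Qed.

Definition cls (t : term) : tclass :=
  exist _ (repr t) (proj2 (repr_eq (repr t) t) (eqv_sym _ _ (repr_eqv t))).

Lemma cls_eq t u : cls t = cls u <-> eqv t u.
Proof. by rewrite -repr_eq; split=> [[]//|e]; apply: tclass_eq. Qed.

Lemma cls_proj (d : tclass) : cls (proj1_sig d) = d.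
Proof. by apply: tclass_eq; apply: (proj2_sig d). Qed.

Lemma proj_cls t : eqv (proj1_sig (cls t)) t.
Proof. by apply/cls_eq; rewrite cls_proj. Qed.

Definition term_model : model := {|
  carrier := tclass;
  mzero := cls TZero;
  mone := cls TOne;
  madd d e := cls (TAdd (proj1_sig d) (proj1_sig e));
  mmul d e := cls (TMul (proj1_sig d) (proj1_sig e));
  mlt d e := holds (Lt (proj1_sig d) (proj1_sig e));
  mmem d X := holds (Mem (proj1_sig d) X) |}.

Lemma eqv_congr2 (f : term -> term -> term) t t' u u' :
  (forall s v w, tsubst s (f v w) = f (tsubst s v) (tsubst s w)) ->
  eqv t t' -> eqv u u' -> eqv (f t u) (f t' u').
Proof.
move=> fs e e'; apply: (eqv_trans _ (f t' u)).
- have := eqv_subst (Eq (f (tshift t) (tshift u)) (f (TVar 0) (tshift u))) _ _ e.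
  by rewrite /inst /= !fs /= !inst_shift; apply; apply: eqv_refl.
- have := eqv_subst (Eq (f (tshift t') (tshift u)) (f (tshift t') (TVar 0))) _ _ e'.
  by rewrite /inst /= !fs /= !inst_shift; apply; apply: eqv_refl.
Qed.

Lemma eval_cls f t : eval term_model (fun n => cls (f n)) t = cls (tsubst f t).
Proof.
elim: t => //= t -> u ->; apply/cls_eq.
- by apply: (eqv_congr2 TAdd) => //; apply: proj_cls.
- by apply: (eqv_congr2 TMul) => //; apply: proj_cls.
Qed.

Lemma holds_Lt_cls t u :
  holds (Lt (proj1_sig (cls t)) (proj1_sig (cls u))) <-> holds (Lt t u).
Proof.
have H v v' w w' : eqv v v' -> eqv w w' -> holds (Lt v w) -> holds (Lt v' w').
  move=> e e' h.
  have := eqv_subst (Lt (TVar 0) (tshift w)) _ _ e; rewrite /inst /= !inst_shift => /(_ h).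
  by have := eqv_subst (Lt (tshift v') (TVar 0)) _ _ e'; rewrite /inst /= !inst_shift.
split; apply: H; try exact: proj_cls; apply: eqv_sym; exact: proj_cls.
Qed.

Lemma holds_Mem_cls t X : holds (Mem (proj1_sig (cls t)) X) <-> holds (Mem t X).
Proof.
have H v v' : eqv v v' -> holds (Mem v X) -> holds (Mem v' X).
  by move=> e; have := eqv_subst (Mem (TVar 0) X) _ _ e; rewrite /inst /=.
split; apply: H; try exact: proj_cls; apply: eqv_sym; exact: proj_cls.
Qed.

(** Every element is the class of a term, so environments of the form [cls (f n)] are all there are,
    and the quantifier case merely extends [f]. *)
Lemma truth p f r : sat term_model (fun n => cls (f n)) r p <-> holds (fsubst f r p).
Proof.
elim: p f r => /=.
- by move=> f r; split=> // /holds_Bot.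
- by move=> p IHp q IHq f r; rewrite IHp IHq holds_Imp.
- by move=> t u f r; rewrite !eval_cls cls_eq.
- by move=> t u f r; rewrite !eval_cls holds_Lt_cls.
- by move=> t X f r; rewrite !eval_cls holds_Mem_cls.
- move=> p IH f r; rewrite -/(up f) holds_All.
  have sc t : scons (cls t) (fun n => cls (f n)) = fun n => cls (scons t f n).
    by apply: functional_extensionality => -[|n].
  split=> [H t|H d].
    by rewrite inst_up -IH -sc.
  by rewrite -(cls_proj d) sc IH -inst_up.
- move=> p IH f r; rewrite -/(upr r) holds_SAll.
  by split=> H Y; have := H Y; rewrite sinst_upr IH.
Qed.

End Henkin.

Definition named (M : model) (s : nat -> M) : Prop := forall d, exists t, d = eval M s t.

Definition models (M : model) (T : form -> Prop) : Prop :=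
  forall p s r, T p -> sat M s r p.

(* Every set of the Henkin model is a set variable, which is why the sets of a
   [model] are natural numbers and set variables may be read as themselves. *)
Theorem completeness T phi :
  (forall M s, named M s -> models M T -> sat M s (fun n => n) phi) ->
  provable T phi.
Proof.
move=> H; apply: NNPP => nphi.
pose T' := subst_closure T.
have cT : subst_closed T' := subst_closure_closed T.
have nphi' : ~ prv T' nil phi by move=> /prv_subst_closure.
pose M := term_model T' phi cT nphi'.
have E t : tsubst TVar t = t by apply: tsubst_id.
have : sat M (fun n => cls T' phi cT nphi' (TVar n)) (fun n => n) phi.
{ apply: H.
- by move=> d; exists (proj1_sig d); rewrite eval_cls E cls_proj.
- move=> p s r Tp.
  have -> : s = fun n => cls T' phi cT nphi' (proj1_sig (s n)).
    by apply: functional_extensionality => n; rewrite cls_proj.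
  rewrite truth; apply: holds_axiom.
  by exists p, TVar, (fun n => n); rewrite fsubst_id. }
rewrite truth fsubst_id => hphi.
have hn : holds T' phi cT nphi' (Neg phi) by exists 0; left.
exact: holds_Neg hn hphi.
Qed.

(** * Definable predicates *)

Lemma eval_tsubst (M : model) s f t :
  eval M s (tsubst f t) = eval M (fun n => eval M s (f n)) t.
Proof. by elim: t => //= t -> u ->. Qed.

Lemma sat_fsubst (M : model) p s r f g :
  sat M s r (fsubst f g p) <-> sat M (fun n => eval M s (f n)) (fun n => r (g n)) p.
Proof.
elim: p s r f g => //=.
- by move=> p IHp q IHq s r f g; rewrite IHp IHq.
- by move=> t u s r f g; rewrite !eval_tsubst.
- by move=> t u s r f g; rewrite !eval_tsubst.
- by move=> t X s r f g; rewrite !eval_tsubst.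
- move=> p IH s r f g; split=> H x; have := H x; rewrite IH;
    (suff -> : (fun n => eval M (scons x s) (scons (TVar 0) (fun m => tshift (f m)) n))
      = scons x (fun n => eval M s (f n)) by []);
    by apply: functional_extensionality => -[|n] //=; rewrite /tshift eval_tsubst.
- move=> p IH s r f g; split=> H x; have := H x; rewrite IH;
    (suff -> : (fun n => scons x r (scons 0 (fun m => S (g m)) n))
      = scons x (fun n => r (g n)) by []);
    by apply: functional_extensionality => -[|n].
Qed.

Lemma bounded_fsubst p s r : bounded p -> bounded (fsubst s r p).
Proof.
move=> H; elim: H s r => /=; try by move=> *; constructor.
move=> t {}p _ IH s r.
have -> : tsubst (scons (TVar 0) (fun n => tshift (s n))) (tshift t)
    = tshift (tsubst s t) by rewrite /tshift !tsubst_comp.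
by constructor.
Qed.

Lemma arithmetical_fsubst p s r : arithmetical p -> arithmetical (fsubst s r p).
Proof.
elim: p s r => //= [p IHp q IHq s r [/IHp hp /IHq hq]|p IH s r]; first by split.
exact: IH.
Qed.

Record rca : Type := Rca {
  rmodel :> model;
  names : nat -> rmodel;
  rnamed : named rmodel names;
  rmodels : models rmodel RCA0 }.

Section Definability.
Variable M : rca.
Notation D := (carrier M).

Fixpoint env (k : nat) : Type :=
  match k with O => unit | S k => (env k * D)%type end.

(** The [k] innermost variables vary, and all further variables denote fixed named parameters. *)
Fixpoint asg (k : nat) : env k -> nat -> D :=
  match k with
  | O => fun _ => names M
  | S k => fun e => scons e.2 (asg k e.1)
  end.

Definition satid (s : nat -> D) (p : form) : Prop := sat M s (fun n => n) p.

Definition class (b : bool) (p : form) : Prop :=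
  if b then arithmetical p else bounded p.

Definition TermDef (k : nat) (f : env k -> D) : Prop :=
  exists t, forall e, f e = eval M (asg k e) t.

(* Arithmetical if [b], and bounded otherwise; as all elements and sets of the
   model are named, parameters are allowed. *)
Definition Def (b : bool) (k : nat) (P : env k -> Prop) : Prop :=
  exists p, class b p /\ forall e, P e <-> satid (asg k e) p.

Lemma asg_names k : exists i, forall e n, asg k e (i + n) = names M n.
Proof.
elim: k => [|k [i IH]]; first by exists 0.
by exists (S i) => e n /=; apply: IH.
Qed.

Lemma term_const k (d : D) : TermDef k (fun _ => d).
Proof.
have [t ->] := rnamed M d; have [i H] := asg_names k.
exists (tsubst (fun n => TVar (i + n)) t) => e.
rewrite eval_tsubst; congr eval; apply: functional_extensionality => n.
by rewrite /= H.
Qed.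

Lemma term_add k f g : TermDef k f -> TermDef k g ->
  TermDef k (fun e => madd M (f e) (g e)).
Proof. by move=> [t ht] [u hu]; exists (TAdd t u) => e /=; rewrite ht hu. Qed.

Lemma term_mul k f g : TermDef k f -> TermDef k g ->
  TermDef k (fun e => mmul M (f e) (g e)).
Proof. by move=> [t ht] [u hu]; exists (TMul t u) => e /=; rewrite ht hu. Qed.

Lemma def_ext b k P Q : (forall e, P e <-> Q e) -> Def b k P -> Def b k Q.
Proof. by move=> H [p [cp hp]]; exists p; split=> // e; rewrite -H. Qed.

Lemma def_imp b k P Q : Def b k P -> Def b k Q -> Def b k (fun e => P e -> Q e).
Proof.
move=> [p [cp hp]] [q [cq hq]]; exists (Imp p q); split.
  by case: b cp cq => /= cp cq; [split|apply: bounded_Imp].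
by move=> e; rewrite hp hq.
Qed.

(** Classically [A] is true or false, and both truth values are given by formulas; facts about the
    model that do not depend on the environment are thus definable at no cost. *)
Lemma def_const b k (A : Prop) : Def b k (fun _ => A).
Proof.
case: (classic A) => H.
- exists (Imp Bot Bot); split; last by move=> e; rewrite /satid /=; tauto.
  by case: b => //=; apply: bounded_Imp; apply: bounded_Bot.
- exists Bot; split; last by move=> e; rewrite /satid /=; tauto.
  by case: b => //=; apply: bounded_Bot.
Qed.

Lemma def_not b k P : Def b k P -> Def b k (fun e => ~ P e).
Proof. by move=> H; apply: def_imp H _; apply: def_const. Qed.

Lemma def_and b k P Q : Def b k P -> Def b k Q -> Def b k (fun e => P e /\ Q e).
Proof.
move=> HP HQ; apply: (def_ext _ _ (fun e => ~ (P e -> ~ Q e))).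
  by move=> e; tauto.
by apply: def_not; apply: def_imp HP _; apply: def_not.
Qed.

Lemma def_or b k P Q : Def b k P -> Def b k Q -> Def b k (fun e => P e \/ Q e).
Proof.
move=> HP HQ; apply: (def_ext _ _ (fun e => (~ P e -> Q e))).
  by move=> e; tauto.
by apply: def_imp HQ; apply: def_not.
Qed.

Lemma def_iff b k P Q : Def b k P -> Def b k Q -> Def b k (fun e => P e <-> Q e).
Proof. by move=> HP HQ; apply: def_and; apply: def_imp. Qed.

Lemma def_eq b k f g : TermDef k f -> TermDef k g -> Def b k (fun e => f e = g e).
Proof.
move=> [t ht] [u hu]; exists (Eq t u); split.
  by case: b => //=; apply: bounded_Eq.
by move=> e; rewrite ht hu.
Qed.

Lemma def_lt b k f g : TermDef k f -> TermDef k g ->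
  Def b k (fun e => mlt M (f e) (g e)).
Proof.
move=> [t ht] [u hu]; exists (Lt t u); split.
  by case: b => //=; apply: bounded_Lt.
by move=> e; rewrite ht hu.
Qed.

Lemma def_mem b k f X : TermDef k f -> Def b k (fun e => mmem M (f e) X).
Proof.
move=> [t ht]; exists (Mem t X); split.
  by case: b => //=; apply: bounded_Mem.
by move=> e; rewrite ht.
Qed.

Lemma def_ball b k f (P : env k -> D -> Prop) :
  TermDef k f -> Def b (S k) (fun e => P e.1 e.2) ->
  Def b k (fun e => forall x, mlt M x (f e) -> P e x).
Proof.
move=> [t ht] [p [cp hp]].
exists (All (Imp (Lt (TVar 0) (tshift t)) p)); split.
  by case: b cp => //= cp; apply: bounded_All.
move=> e; rewrite /satid /=.
by split=> H x; have := H x; have := hp (e, x); rewrite /= ht /tshift eval_tsubst /= => ->.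
Qed.

Lemma def_bex b k f (P : env k -> D -> Prop) :
  TermDef k f -> Def b (S k) (fun e => P e.1 e.2) ->
  Def b k (fun e => exists x, mlt M x (f e) /\ P e x).
Proof.
move=> hf hP; apply: (def_ext _ _ (fun e => ~ forall x, mlt M x (f e) -> ~ P e x)).
  move=> e; split=> [H|[x [l h]] H]; last exact: H h.
  by apply: NNPP => nH; apply: H => x l h; apply: nH; exists x.
by apply: def_not; apply: def_ball hf _; apply: def_not.
Qed.

Lemma def_all k (P : env k -> D -> Prop) :
  Def true (S k) (fun e => P e.1 e.2) -> Def true k (fun e => forall x, P e x).
Proof.
move=> [p [cp hp]]; exists (All p); split=> // e.
rewrite /satid /=; split=> H x; first by apply/(hp (e, x)); apply: H.
by apply/(hp (e, x)); apply: H.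
Qed.

Lemma def_ex k (P : env k -> D -> Prop) :
  Def true (S k) (fun e => P e.1 e.2) -> Def true k (fun e => exists x, P e x).
Proof.
move=> hP; apply: (def_ext _ _ (fun e => ~ forall x, ~ P e x)).
  move=> e; split=> [H|[x h] H]; last exact: H h.
  by apply: NNPP => nH; apply: H => x h; apply: nH; exists x.
by apply: def_not; apply: def_all; apply: def_not.
Qed.

(** The changes of environment that are induced by a substitution of terms, along which definable
    predicates can be pulled back. *)
Definition EnvDef (j k : nat) (f : env j -> env k) : Prop :=
  exists s, forall e n, asg k (f e) n = eval M (asg j e) (s n).

Lemma envdef_tt j : EnvDef j 0 (fun _ => tt).
Proof. by have [i H] := asg_names j; exists (fun n => TVar (i + n)) => e n /=; rewrite H. Qed.

Lemma envdef_pair j k f g : EnvDef j k f -> TermDef j g ->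
  EnvDef j (S k) (fun e => (f e, g e)).
Proof.
by move=> [s hs] [t ht]; exists (scons t s) => e [|n] /=; [rewrite ht|apply: hs].
Qed.

Lemma envdef_fst j k f : EnvDef j k f -> EnvDef (S j) k (fun e => f e.1).
Proof.
move=> [s hs]; exists (fun n => tshift (s n)) => e n.
by rewrite hs /tshift eval_tsubst.
Qed.

Lemma envdef_id j : EnvDef j j (fun e => e).
Proof. by exists TVar. Qed.

Lemma def_sub b j k P f : Def b k P -> EnvDef j k f -> Def b j (fun e => P (f e)).
Proof.
move=> [p [cp hp]] [s hs]; exists (fsubst s (fun n => n) p); split.
  by case: b cp; [apply: arithmetical_fsubst|apply: bounded_fsubst].
move=> e; rewrite /satid sat_fsubst hp.
have -> // : asg k (f e) = fun n => eval M (asg j e) (s n).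
by apply: functional_extensionality => n; apply: hs.
Qed.

Lemma term_sub j k (f : env k -> D) g :
  TermDef k f -> EnvDef j k g -> TermDef j (fun e => f (g e)).
Proof.
move=> [t ht] [s hs]; exists (tsubst s t) => e.
rewrite ht eval_tsubst; congr eval; apply: functional_extensionality => n.
exact: hs.
Qed.

Definition Def1 b (P : D -> Prop) := Def b 1 (fun e => P e.2).
Definition Def2 b (P : D -> D -> Prop) := Def b 2 (fun e => P e.1.2 e.2).

Lemma def_app1 b k P f : Def1 b P -> TermDef k f -> Def b k (fun e => P (f e)).
Proof.
move=> hP hf; exact: (def_sub b k 1 (fun e => P e.2) (fun e => (tt, f e)) hP
  (envdef_pair _ _ _ _ (envdef_tt _) hf)).
Qed.

Lemma def_app2 b k P f g : Def2 b P -> TermDef k f -> TermDef k g ->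
  Def b k (fun e => P (f e) (g e)).
Proof.
move=> hP hf hg.
exact: (def_sub b k 2 (fun e => P e.1.2 e.2) (fun e => (tt, f e, g e)) hP
  (envdef_pair _ _ _ _ (envdef_pair _ _ _ _ (envdef_tt _) hf) hg)).
Qed.

End Definability.

(** * Automation for definability *)

Ltac tvar i :=
  first [exists (TVar i); intro; reflexivity
        (* The search limit exceeds the deepest environment that occurs, which has about twenty
           variables, in [def_good]. *)
        | lazymatch i with 24 => fail | _ => tvar (S i) end].

Ltac term_def :=
  cbv beta;
  first [ apply: term_const | apply: term_add; term_def | apply: term_mul; term_def
        | assumption | tvar 0 ].

Ltac def_step :=
  cbv beta;
  first
  [ assumption | apply: def_const
  | apply: def_ball; [term_def|] | apply: def_bex; [term_def|]
  | apply: def_eq; term_def | apply: def_lt; term_def | apply: def_mem; term_def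
  | apply: def_not | apply: def_and | apply: def_or | apply: def_iff | apply: def_imp
  | apply: def_all | apply: def_ex
  | (apply: def_app1; [eassumption|term_def..])
  | (apply: def_app2; [eassumption|term_def..]) ].

Ltac def := rewrite ?/Def1 ?/Def2; repeat def_step.

(** * Induction and comprehension inside a model *)

Section Schemas.
Variable M : rca.
Notation D := (carrier M).
Local Notation "0" := (mzero M).
Local Notation "1" := (mone M).
Local Notation "x + y" := (madd M x y).

Lemma sat_And s r p q : sat M s r (And p q) <-> sat M s r p /\ sat M s r q.
Proof. by rewrite /=; tauto. Qed.

Lemma sat_Ex s r p : sat M s r (Ex p) <-> exists x, sat M (scons x s) r p.
Proof.
rewrite /=; split=> [H|[x h] H]; last exact: H h.
by apply: NNPP => nH; apply: H => x h; apply: nH; exists x.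
Qed.

Lemma sat_comprehension s p : satid M s (comprehension p) ->
  exists X, forall x, mmem M x X <-> satid M (scons x s) p.
Proof.
rewrite /satid /comprehension /= => H; apply: NNPP => nH; apply: H => X HX.
apply: nH; exists X => x; have := HX x.
rewrite sat_fsubst /=.
have -> : (fun n => scons x s n) = scons x s by [].
by tauto.
Qed.

Lemma Delta0_ind (P : D -> Prop) : Def1 M false P ->
  P 0 -> (forall x, P x -> P (x + 1)) -> forall x, P x.
Proof.
move=> [p [cp hp]] P0 PS x.
(* A vacuous existential quantifier turns the bounded formula into an instance of the Sigma-1
   schema. *)
have hS : sigma1 (Ex (nshift p)) by exists (nshift p); split=> //; apply: bounded_fsubst.
have := rmodels M _ (names M) (fun n => n) (RCA0_induction _ hS).
have E y : sat M (scons y (names M)) (fun n => n) (Ex (nshift p)) <-> P y.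
{ rewrite sat_Ex (hp (tt, y)); split=> [[z]|H]; last exists y; by rewrite /nshift sat_fsubst. }
rewrite /induction /=; move=> /(_ _ x) H.
apply/E; apply: H => H; apply: H; last first.
- move=> y /E Py; apply: (iffRL (sat_fsubst M (Ex (nshift p)) _ _ _ _)).
  have -> : (fun n => eval M (scons y (names M)) (scons (TAdd (TVar O) TOne) (fun m => TVar (S m)) n)) = scons (y + 1) (names M).
    by apply: functional_extensionality => -[|n].
  by apply/E; apply: PS.
- apply: (iffRL (sat_fsubst M (Ex (nshift p)) _ _ _ _)).
  have -> : (fun n => eval M (names M) (scons TZero TVar n)) = scons 0 (names M).
    by apply: functional_extensionality => -[|n].
  exact/E.
Qed.

Lemma Delta1_CA (P Q : D -> D -> Prop) : Def2 M false P -> Def2 M false Q ->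
  (forall x, (exists y, P x y) <-> (forall y, Q x y)) ->
  exists X, forall x, mmem M x X <-> exists y, P x y.
Proof.
move=> [p [cp hp]] [q [cq hq]] H.
have sp : sigma1 (Ex p) by exists p.
have sq : pi1 (All q) by exists q.
have EP x : sat M (scons x (names M)) (fun n => n) (Ex p) <-> exists y, P x y.
  by rewrite sat_Ex; split=> -[y h]; exists y; have := hp (tt, x, y); rewrite /satid /=; tauto.
have EQ x : sat M (scons x (names M)) (fun n => n) (All q) <-> forall y, Q x y.
  by split=> h y; have := h y; have := hq (tt, x, y); rewrite /satid /=; tauto.
have /sat_comprehension [X hX] : satid M (names M) (comprehension (Ex p)).
  apply: (rmodels M _ (names M) (fun n => n) (RCA0_comprehension _ _ sp sq)) => x.
  change (sat M (scons x (names M)) (fun n => n) (Iff (Ex p) (All q))).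
  by rewrite /Iff sat_And; have := EP x; have := EQ x; have := H x; rewrite /=; tauto.
by exists X => x; rewrite hX -EP.
Qed.

Lemma Delta0_CA (P : D -> Prop) : Def1 M false P ->
  exists X, forall x, mmem M x X <-> P x.
Proof.
move=> hP.
have [X hX] : exists X, forall x, mmem M x X <-> exists y : D, P x.
  by apply: (Delta1_CA (fun x y => P x) (fun x y => P x)); [def|def|move=> x; split=> [[]|/(_ 0)] //; exists 0].
by exists X => x; rewrite hX; split=> [[]|] //; exists 0.
Qed.

End Schemas.

(** * Arithmetic in models of RCA_0 *)

Section Arithmetic.
Variable M : rca.
Notation D := (carrier M).
Local Notation "0" := (mzero M).
Local Notation "1" := (mone M).
Local Notation "x + y" := (madd M x y).
Local Notation "x * y" := (mmul M x y).
Local Notation "x < y" := (mlt M x y).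

Lemma basic_axiom (n : nat) : Nat.lt n 8 -> satid M (names M) (nth n basic_axioms Bot).
Proof.
move=> h; apply: rmodels; apply: RCA0_basic; apply: nth_In.
by rewrite /basic_axioms length_map /=.
Qed.

Ltac basic n := move: (basic_axiom n ltac:(lia)); rewrite /satid /=.

Lemma succ_neq0 n : n + 1 <> 0.
Proof. by basic 0%nat; apply. Qed.
Lemma succ_inj m n : m + 1 = n + 1 -> m = n.
Proof. by basic 1%nat; apply. Qed.
Lemma addm0 m : m + 0 = m.
Proof. by basic 2%nat; apply. Qed.
Lemma addmS m n : m + (n + 1) = (m + n) + 1.
Proof. by basic 3%nat; apply. Qed.
Lemma mulm0 m : m * 0 = 0.
Proof. by basic 4%nat; apply. Qed.
Lemma mulmS m n : m * (n + 1) = (m * n) + m.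
Proof. by basic 5%nat; apply. Qed.
Lemma ltm0 m : ~ m < 0.
Proof. by basic 6%nat; apply. Qed.
Lemma ltmS m n : m < n + 1 <-> m < n \/ m = n.
Proof. by basic 7%nat; move=> /(_ m n); tauto. Qed.

Lemma add0m m : 0 + m = m.
Proof.
move: m; apply: Delta0_ind; [by def|by rewrite addm0|].
by move=> x e; rewrite addmS e.
Qed.

Lemma addSm m n : (m + 1) + n = (m + n) + 1.
Proof.
move: n; apply: Delta0_ind; [by def|by rewrite !addm0|].
by move=> x e; rewrite !addmS e.
Qed.

Lemma addmC m n : m + n = n + m.
Proof.
move: n; apply: Delta0_ind; [by def|by rewrite addm0 add0m|].
by move=> x e; rewrite addmS addSm e.
Qed.

Lemma addmA m n k : m + (n + k) = (m + n) + k.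
Proof.
move: k; apply: Delta0_ind; [by def|by rewrite !addm0|].
by move=> x e; rewrite !addmS e.
Qed.

Lemma mul0m m : 0 * m = 0.
Proof.
move: m; apply: Delta0_ind; [by def|by rewrite mulm0|].
by move=> x e; rewrite mulmS e addm0.
Qed.

Lemma mulSm m n : (m + 1) * n = (m * n) + n.
Proof.
move: n; apply: Delta0_ind; [by def|by rewrite !mulm0 addm0|].
move=> x e; rewrite !mulmS e !addmS; congr madd.
by rewrite -!addmA (addmC x m).
Qed.

Lemma mulmC m n : m * n = n * m.
Proof.
move: n; apply: Delta0_ind; [by def|by rewrite mulm0 mul0m|].
by move=> x e; rewrite mulmS mulSm e.
Qed.

Lemma mulmDl m n k : (m + n) * k = m * k + n * k.
Proof.
move: k; apply: Delta0_ind; [by def|by rewrite !mulm0 addm0|].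
move=> x e; rewrite !mulmS e -!addmA; congr madd.
by rewrite !addmA (addmC m).
Qed.

Lemma mulmA m n k : m * (n * k) = (m * n) * k.
Proof.
move: k; apply: Delta0_ind; [by def|by rewrite !mulm0|].
by move=> x e; rewrite !mulmS -e (mulmC m) mulmDl (mulmC m) (mulmC m).
Qed.

Lemma mul1m m : 1 * m = m.
Proof. by rewrite -{1}(add0m 1) mulSm mul0m add0m. Qed.

Lemma D_semi_ring : semi_ring_theory 0 1 (madd M) (mmul M) eq.
Proof.
split; [exact: add0m|exact: addmC|exact: addmA|exact: mul1m|exact: mul0m
  |exact: mulmC|exact: mulmA|exact: mulmDl].
Qed.

Add Ring D_ring : D_semi_ring.

Lemma addmI m n k : m + k = n + k -> m = n.
Proof.
move: k; apply: Delta0_ind; [by def|by rewrite !addm0|].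
by move=> x e; rewrite !addmS => /succ_inj.
Qed.

Lemma lt0S m : 0 < m + 1.
Proof.
move: m; apply: Delta0_ind; first by def.
  by apply/ltmS; right.
by move=> x h; apply/ltmS; left.
Qed.

Lemma ltSS m n : m < n -> m + 1 < n + 1.
Proof.
move: n m; apply: Delta0_ind; [by def|by move=> m /ltm0|].
move=> x IH m /ltmS [/IH h|->]; apply/ltmS; by [left|right].
Qed.

Lemma lt_addS m k : m < m + (k + 1).
Proof.
move: k; apply: Delta0_ind; first by def.
  by rewrite add0m; apply/ltmS; right.
by move=> x h; rewrite addmS; apply/ltmS; left.
Qed.

Lemma ltm_addP m n : m < n <-> exists k, n = m + (k + 1).
Proof.
split=> [|[k ->]]; last exact: lt_addS.
(* Bounding the witness makes the statement bounded, so that [Delta0_ind] applies to it. *)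
move: m => m0 h; suff : exists k, k < n /\ n = m0 + (k + 1) by move=> [k [_ ->]]; exists k.
move: n m0 h; apply: Delta0_ind; [by def|by move=> m /ltm0|].
move=> x IH m /ltmS [/IH [k [l e]]|->].
- by exists (k + 1); split; [apply: ltSS|rewrite {1}e; ring].
- by exists 0; split; [apply: lt0S|ring].
Qed.

Lemma ltm_irr m : ~ m < m.
Proof.
move=> /ltm_addP [k e]; apply: (succ_neq0 k); apply: (addmI _ _ m).
by rewrite addmC -e; ring.
Qed.

Lemma ltm_trans m n k : m < n -> n < k -> m < k.
Proof. by move=> /ltm_addP [a ->] /ltm_addP [b ->]; apply/ltm_addP; exists (a + b + 1); ring. Qed.

Lemma zeroVsucc m : m = 0 \/ exists n, m = n + 1.
Proof.
suff : m = 0 \/ exists n, n < m /\ m = n + 1 by move=> [->|[n [_ ->]]]; [left|right; exists n].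
move: m; apply: Delta0_ind; [by def|by left|].
by move=> x _; right; exists x; split=> //; apply/ltmS; right.
Qed.

Lemma ltm_total m n : m < n \/ m = n \/ n < m.
Proof.
move: m; apply: Delta0_ind; first by def.
  by case: (zeroVsucc n) => [->|[k ->]]; [right; left|left; apply: lt0S].
move=> x [/ltm_addP [k ->]|[->|h]].
- case: (zeroVsucc k) => [->|[j ->]]; first by right; left; ring.
  by left; apply/ltm_addP; exists j; ring.
- by right; right; apply/ltmS; right.
- by right; right; apply/ltmS; left.
Qed.

Lemma mulmI m n k : m * (k + 1) = n * (k + 1) -> m = n.
Proof.
have H a b : ~ a * (k + 1) = (a + (b + 1)) * (k + 1).
  move=> e; apply: (succ_neq0 (b * k + b + k)); apply: (addmI _ _ (a * (k + 1))).
  by rewrite {2}e; ring.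
case: (ltm_total m n) => [/ltm_addP [b ->] /H //|[-> //|/ltm_addP [b ->] e]].
by case: (H n b).
Qed.

Lemma ltm_mul2r m n k : m * (k + 1) < n * (k + 1) <-> m < n.
Proof.
have H a b : a < b -> a * (k + 1) < b * (k + 1).
  by move=> /ltm_addP [c ->]; apply/ltm_addP; exists (c * k + c + k); ring.
split; last exact: H.
by case: (ltm_total m n) => [//|[-> /ltm_irr //|/H h h']]; case: (ltm_irr _ (ltm_trans _ _ _ h h')).
Qed.

Lemma add_eq0 m n : m + n = 0 -> m = 0.
Proof.
case: (zeroVsucc m) => [-> //|[k ->]] e; case: (succ_neq0 (k + n)).
by rewrite -e; ring.
Qed.

Lemma mul_eq0S m n : m * (n + 1) = 0 -> m = 0.
Proof. by rewrite mulmS addmC => /add_eq0. Qed.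

Lemma Delta0_least (P : D -> Prop) n : Def1 M false P -> P n ->
  exists m, P m /\ forall k, k < m -> ~ P k.
Proof.
move=> hP Pn; apply: NNPP => H.
suff nP x : forall y, y < x -> ~ P y by apply: (nP (n + 1) n) => //; apply/ltmS; right.
move: x; apply: Delta0_ind; [by def|by move=> y /ltm0|].
by move=> x IH y /ltmS [/IH //|-> Px]; apply: H; exists x.
Qed.

(** * Pairing *)

Definition mpair (m n : D) : D := (m + n) * (m + n) + m.

(** The code lies between the square of [m + n] and the next square, so it determines the sum, and
    then [m] as the remainder. *)
Lemma mpair_inj m n m' n' : mpair m n = mpair m' n' -> m = m' /\ n = n'.
Proof.
have H a b a' b' : a + b < a' + b' -> mpair a b = mpair a' b' -> False.
  (* The successor of this number is the difference of the two codes, written without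
     subtraction. *)
  move=> /ltm_addP [k e] e'; apply: (succ_neq0 (a + b + b + k * k + k + k + (a + b) * (k + k) + a')).
  apply: (addmI _ _ (mpair a b)).
  by rewrite {2}e' /mpair e; ring.
case: (ltm_total (m + n) (m' + n')) => [/H h /h //|[e|/H h /esym /h //]].
rewrite /mpair e addmC (addmC _ m') => /addmI em; split=> //.
by move: e; rewrite em addmC (addmC m') => /addmI.
Qed.

(** Bounds of this kind turn decoding into bounded quantification, so that [Delta0_CA] and
    [Delta0_least] apply to coded tuples. *)
Lemma lt_mpair_l m n : m < mpair m n + 1.
Proof. by apply/ltm_addP; exists ((m + n) * (m + n)); rewrite /mpair; ring. Qed.

Lemma lt_mpair_r m n : n < mpair m n + 1.
Proof.
case: (zeroVsucc n) => [->|[k ->]]; first exact: lt0S.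
by apply/ltm_addP; exists ((m + (k + 1)) * (m + k) + m + m); rewrite /mpair; ring.
Qed.

(** * Fractions *)

(* The semantic counterpart of [frac]: [(tpos - tneg) / (tden + 1)]. *)
Record trip : Type := Trip { tpos : D; tneg : D; tden : D }.

Definition qeq (f g : trip) : Prop :=
  tpos f * (tden g + 1) + tneg g * (tden f + 1) =
  tpos g * (tden f + 1) + tneg f * (tden g + 1).
Definition qlt (f g : trip) : Prop :=
  tpos f * (tden g + 1) + tneg g * (tden f + 1) <
  tpos g * (tden f + 1) + tneg f * (tden g + 1).
Definition qopp (f : trip) : trip := Trip (tneg f) (tpos f) (tden f).
Definition qadd (f g : trip) : trip :=
  Trip (tpos f * (tden g + 1) + tpos g * (tden f + 1))
       (tneg f * (tden g + 1) + tneg g * (tden f + 1))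
       (tden f * tden g + tden f + tden g).
Definition qmul (f g : trip) : trip :=
  Trip (tpos f * tpos g + tneg f * tneg g) (tpos f * tneg g + tneg f * tpos g)
       (tden f * tden g + tden f + tden g).
Definition qzero : trip := Trip 0 0 0.
Definition qone : trip := Trip 1 0 0.

Lemma qeq_refl f : qeq f f.
Proof. by []. Qed.

Lemma qeq_sym f g : qeq f g -> qeq g f.
Proof. by rewrite /qeq => ->. Qed.

(** In the absence of subtraction, the middle fraction is eliminated by adding its terms to both
    sides and cancelling them. *)
Lemma qeq_trans f g h : qeq f g -> qeq g h -> qeq f h.
Proof.
case: f g h => [a b c] [a' b' c'] [a2 b2 c2]; rewrite /qeq /= => e e'.
apply: (mulmI _ _ c').
apply: (addmI _ _ (a' * (c + 1) * (c2 + 1) + b' * (c + 1) * (c2 + 1))).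
transitivity ((a * (c' + 1) + b' * (c + 1)) * (c2 + 1)
  + (a' * (c2 + 1) + b2 * (c' + 1)) * (c + 1)); first by ring.
by rewrite e e'; ring.
Qed.

Lemma qadd_congr f f' g : qeq f f' -> qeq (qadd f g) (qadd f' g).
Proof.
case: f f' g => [a b c] [a' b' c'] [x y z]; rewrite /qeq /= => e.
transitivity ((a * (c' + 1) + b' * (c + 1)) * ((z + 1) * (z + 1))
  + (x + y) * ((c + 1) * (c' + 1) * (z + 1))); first by ring.
by rewrite e; ring.
Qed.

Lemma qmul_congr f f' g : qeq f f' -> qeq (qmul f g) (qmul f' g).
Proof.
case: f f' g => [a b c] [a' b' c'] [x y z]; rewrite /qeq /= => e.
transitivity ((a * (c' + 1) + b' * (c + 1)) * (x * (z + 1))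
  + (a' * (c + 1) + b * (c' + 1)) * (y * (z + 1))); first by ring.
by rewrite e -{2}e; ring.
Qed.

Lemma qopp_congr f f' : qeq f f' -> qeq (qopp f) (qopp f').
Proof. by case: f f' => [a b c] [a' b' c']; rewrite /qeq /= => e; rewrite addmC -e; ring. Qed.

Lemma qaddA f g h : qeq (qadd f (qadd g h)) (qadd (qadd f g) h).
Proof. by rewrite /qeq /=; ring. Qed.

Lemma qaddC f g : qadd f g = qadd g f.
Proof. by rewrite /qadd; congr Trip; ring. Qed.

Lemma qadd0 f : qeq (qadd qzero f) f.
Proof. by rewrite /qeq /=; ring. Qed.

Lemma qaddN f : qeq (qadd (qopp f) f) qzero.
Proof. by rewrite /qeq /=; ring. Qed.

Lemma qmulA f g h : qeq (qmul f (qmul g h)) (qmul (qmul f g) h).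
Proof. by rewrite /qeq /=; ring. Qed.

Lemma qmulC f g : qmul f g = qmul g f.
Proof. by rewrite /qmul; congr Trip; ring. Qed.

Lemma qmul1 f : qeq (qmul qone f) f.
Proof. by rewrite /qeq /=; ring. Qed.

Lemma qmulDl f g h : qeq (qmul (qadd f g) h) (qadd (qmul f h) (qmul g h)).
Proof. by rewrite /qeq /=; ring. Qed.

Lemma qone_neq0 : ~ qeq qone qzero.
Proof.
rewrite /qeq /= => e; apply: (succ_neq0 0).
by transitivity (1 * (0 + 1) + 0 * (0 + 1)); [ring|rewrite e; ring].
Qed.

Lemma qsign f : qeq f qzero \/
  exists a c, qeq f (Trip (a + 1) 0 c) \/ qeq f (Trip 0 (a + 1) c).
Proof.
case: f => [a b c]; case: (ltm_total a b) => [/ltm_addP [k ->]|[->|/ltm_addP [k ->]]].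
- by right; exists k, c; right; rewrite /qeq /=; ring.
- by left; rewrite /qeq /=; ring.
- by right; exists k, c; left; rewrite /qeq /=; ring.
Qed.

Lemma qinv f : ~ qeq f qzero -> exists g, qeq (qmul g f) qone.
Proof.
case: (qsign f) => [//|[a [c h]]] _.
case: h => h; [exists (Trip (c + 1) 0 a)|exists (Trip 0 (c + 1) a)].
- by rewrite qmulC; apply: qeq_trans (qmul_congr _ _ _ h) _; rewrite /qeq /=; ring.
- by rewrite qmulC; apply: qeq_trans (qmul_congr _ _ _ h) _; rewrite /qeq /=; ring.
Qed.

Lemma qnneg_anti a c a' c' :
  qeq (Trip a 0 c) (qopp (Trip a' 0 c')) -> qeq (Trip a 0 c) qzero.
Proof.
rewrite /qeq /=; have -> : 0 * (c + 1) + 0 * (c' + 1) = 0 by ring.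
by move=> /add_eq0 /mul_eq0S ->; ring.
Qed.

Lemma qltP f g : qlt f g <-> exists a c, qeq (qadd g (qopp f)) (Trip (a + 1) 0 c).
Proof.
case: f g => [a b c] [a' b' c']; rewrite /qlt /qeq /=; split.
  move=> /ltm_addP [k e]; exists k, (c' * c + c' + c); rewrite e; ring.
move=> [k [d e]]; apply/(ltm_mul2r _ _ d); apply/ltm_addP.
exists (k * (c' * c + c' + c) + k + (c' * c + c' + c)).
transitivity ((a' * (c + 1) + b * (c' + 1)) * (d + 1)
  + 0 * (c' * c + c' + c + 1)); first by ring.
by rewrite e; ring.
Qed.

Lemma qeq_succ j m : qeq (Trip (j + 1) 0 m) (qadd (Trip j 0 m) (Trip 1 0 m)).
Proof. by rewrite /qeq /=; ring. Qed.

(** The Archimedean property relative to [D]: a positive fraction with denominator [c + 1] is at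
    least [1/(c+1)], hence above [1/(c+2)]. *)
Lemma qlt_unit_fraction f : qlt qzero f -> exists m, qlt (Trip 1 0 m) f.
Proof.
case: f => [a b c] /ltm_addP [k /= e]; exists (c + 1); apply/ltm_addP => /=.
have -> : a = b + (k + 1) by transitivity (a * (0 + 1) + 0 * (c + 1)); [ring|rewrite e; ring].
by exists (k * (c + 1 + 1)); ring.
Qed.

End Arithmetic.

From HB Require Import structures.
From mathcomp Require Import ssreflect ssrfun ssrbool eqtype choice ssralg order ssrnum.
From mathcomp Require Import boolp ring lra.
Import GRing.Theory Num.Theory Order.TTheory.

(** * The ordered field of fractions *)

(** Fractions are replaced by their classes so that equality of rationals is equality of elements,
    as the algebraic structures require. *)
Definition quot (M : rca) : Type := {P : trip M -> Prop | exists f, P = qeq M f}.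

Section Quotient.
Variable M : rca.

Definition mk (f : trip M) : quot M := exist _ (qeq M f) (ex_intro _ f erefl).

Lemma mk_eq f g : mk f = mk g <-> qeq M f g.
Proof.
split=> [[e]|e]; first by rewrite e; apply: qeq_refl.
apply: eq_exist; apply: functional_extensionality => h; apply: propositional_extensionality.
by split; apply: qeq_trans => //; apply: qeq_sym.
Qed.

Lemma mk_surj q : exists f, q = mk f.
Proof. by case: q => P [f e]; exists f; apply: eq_exist. Qed.

Definition rep (q : quot M) : trip M := sval (cid (mk_surj q)).

Lemma repK q : mk (rep q) = q.
Proof. by rewrite /rep; case: cid. Qed.

Lemma rep_mk f : qeq M (rep (mk f)) f.
Proof. by apply/mk_eq; rewrite repK. Qed.

Definition quot_add q q' := mk (qadd M (rep q) (rep q')).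
Definition quot_mul q q' := mk (qmul M (rep q) (rep q')).
Definition quot_opp q := mk (qopp M (rep q)).

Lemma quot_addE f g : quot_add (mk f) (mk g) = mk (qadd M f g).
Proof.
apply/mk_eq; apply: qeq_trans (qadd_congr _ _ _ _ (rep_mk f)) _.
by rewrite qaddC (qaddC _ f); apply: qadd_congr; apply: rep_mk.
Qed.

Lemma quot_mulE f g : quot_mul (mk f) (mk g) = mk (qmul M f g).
Proof.
apply/mk_eq; apply: qeq_trans (qmul_congr _ _ _ _ (rep_mk f)) _.
by rewrite qmulC (qmulC _ f); apply: qmul_congr; apply: rep_mk.
Qed.

Lemma quot_oppE f : quot_opp (mk f) = mk (qopp M f).
Proof. by apply/mk_eq; apply: qopp_congr; apply: rep_mk. Qed.

Lemma quot_addA : associative quot_add.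
Proof.
move=> x y z; rewrite -(repK x) -(repK y) -(repK z) !quot_addE.
by apply/mk_eq; apply: qaddA.
Qed.

Lemma quot_addC : commutative quot_add.
Proof. by move=> x y; rewrite /quot_add qaddC. Qed.

Lemma quot_add0 : left_id (mk (qzero M)) quot_add.
Proof. by move=> x; rewrite -(repK x) quot_addE; apply/mk_eq; apply: qadd0. Qed.

Lemma quot_addN : left_inverse (mk (qzero M)) quot_opp quot_add.
Proof. by move=> x; rewrite -(repK x) quot_oppE quot_addE; apply/mk_eq; apply: qaddN. Qed.

HB.instance Definition _ := gen_eqMixin (quot M).
HB.instance Definition _ := gen_choiceMixin (quot M).
HB.instance Definition _ :=
  GRing.isZmodule.Build (quot M) quot_addA quot_addC quot_add0 quot_addN.

Lemma quot_mulA : associative quot_mul.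
Proof.
move=> x y z; rewrite -(repK x) -(repK y) -(repK z) !quot_mulE.
by apply/mk_eq; apply: qmulA.
Qed.

Lemma quot_mulC : commutative quot_mul.
Proof. by move=> x y; rewrite /quot_mul qmulC. Qed.

Lemma quot_mul1 : left_id (mk (qone M)) quot_mul.
Proof. by move=> x; rewrite -(repK x) quot_mulE; apply/mk_eq; apply: qmul1. Qed.

Lemma quot_mulDl : left_distributive quot_mul quot_add.
Proof.
move=> x y z; rewrite -(repK x) -(repK y) -(repK z) !(quot_mulE, quot_addE).
by apply/mk_eq; apply: qmulDl.
Qed.

Lemma quot_one_neq0 : mk (qone M) != 0%R.
Proof. by apply/eqP => /mk_eq; apply: qone_neq0. Qed.

HB.instance Definition _ := GRing.Zmodule_isComNzRing.Build (quot M)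
  quot_mulA quot_mulC quot_mul1 quot_mulDl quot_one_neq0.

Local Open Scope ring_scope.

Lemma quot_inv_exists (x : quot M) : x != 0 -> exists y, y * x = 1.
Proof.
move=> /eqP x0; have [|g hg] := qinv M (rep x).
  by move=> h; apply: x0; rewrite -(repK x); apply/mk_eq.
by exists (mk g); rewrite -(repK x); change (quot_mul (mk g) (mk (rep x)) = mk (qone M)); rewrite quot_mulE; apply/mk_eq.
Qed.

Definition quot_inv (x : quot M) : quot M :=
  if x == 0 then 0 else epsilon (inhabits 0) (fun y => y * x = 1).

Lemma quot_mulV x : x != 0 -> quot_inv x * x = 1.
Proof.
move=> x0; rewrite /quot_inv (negbTE x0).
by apply: (epsilon_spec (inhabits 0) (fun y => y * x = 1)); apply: quot_inv_exists.
Qed.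

Lemma quot_inv0 : quot_inv 0 = 0.
Proof. by rewrite /quot_inv eqxx. Qed.

HB.instance Definition _ := GRing.ComNzRing_isField.Build (quot M) quot_mulV quot_inv0.

Definition nneg (x : quot M) : Prop := exists a c, x = mk (Trip M a (mzero M) c).
Definition quot_le (x y : quot M) : bool := `[< nneg (y - x) >].
Definition quot_lt (x y : quot M) : bool := (y != x) && quot_le x y.
Definition quot_norm (x : quot M) : quot M := if quot_le 0 x then x else - x.

Lemma mkD f g : mk f + mk g = mk (qadd M f g).
Proof. exact: quot_addE. Qed.
Lemma mkM f g : mk f * mk g = mk (qmul M f g).
Proof. exact: quot_mulE. Qed.
Lemma mkN f : - mk f = mk (qopp M f).
Proof. exact: quot_oppE. Qed.

Lemma quot_le0 x : quot_le 0 x = `[< nneg x >].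
Proof. by rewrite /quot_le subr0. Qed.

Lemma quot_le0_add x y : quot_le 0 x -> quot_le 0 y -> quot_le 0 (x + y).
Proof.
rewrite !quot_le0 => /asboolP [a [c ->]] /asboolP [a' [c' ->]]; apply/asboolP.
by rewrite mkD; do 2 eexists; apply/mk_eq; rewrite /qadd /= !mul0m addm0; apply: qeq_refl.
Qed.

Lemma quot_le0_mul x y : quot_le 0 x -> quot_le 0 y -> quot_le 0 (x * y).
Proof.
rewrite !quot_le0 => /asboolP [a [c ->]] /asboolP [a' [c' ->]]; apply/asboolP.
by rewrite mkM; do 2 eexists; apply/mk_eq; rewrite /qmul /= !(mul0m, mulm0, addm0); apply: qeq_refl.
Qed.

Lemma quot_le0_anti x : quot_le 0 x -> quot_le x 0 -> x = 0.
Proof.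
rewrite quot_le0 /quot_le sub0r => /asboolP [a [c e]] /asboolP [a' [c' e']].
have /mk_eq /qnneg_anti : mk (Trip M a (mzero M) c) = mk (qopp M (Trip M a' (mzero M) c')).
  by rewrite -mkN -e -e' opprK.
by rewrite e => h; apply/mk_eq.
Qed.

Lemma quot_sub_ge0 x y : quot_le 0 (y - x) = quot_le x y.
Proof. by rewrite quot_le0. Qed.

Lemma quot_le0_total x : quot_le 0 x || quot_le x 0.
Proof.
rewrite quot_le0 /quot_le sub0r.
case: (qsign M (rep x)) => [/mk_eq e|[a [c [/mk_eq e|/mk_eq e]]]].
- by apply/orP; left; apply/asboolP; rewrite -(repK x) e; do 2 eexists.
- by apply/orP; left; apply/asboolP; rewrite -(repK x) e; do 2 eexists.
- by apply/orP; right; apply/asboolP; rewrite -(repK x) e mkN /qopp /=; do 2 eexists.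
Qed.

Lemma quot_ge0_norm x : quot_le 0 x -> quot_norm x = x.
Proof. by rewrite /quot_norm => ->. Qed.

Lemma quot_normN x : quot_norm (- x) = quot_norm x.
Proof.
have E : quot_le 0 (- x) = quot_le x 0 by rewrite -[RHS]quot_sub_ge0 sub0r.
rewrite /quot_norm E opprK; have := quot_le0_total x.
have := quot_le0_anti x.
by case: (quot_le 0 x); case: (quot_le x 0) => //= /(_ isT isT) ->; rewrite oppr0.
Qed.

Lemma quot_lt_def x y : quot_lt x y = (y != x) && quot_le x y.
Proof. by []. Qed.

HB.instance Definition _ := Num.IntegralDomain_isLeReal.Build (quot M)
  quot_le0_add quot_le0_mul quot_le0_anti quot_sub_ge0 quot_le0_total
  quot_normN quot_ge0_norm quot_lt_def.

Lemma mk_lt f g : mk f < mk g <-> qlt M f g.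
Proof.
rewrite qltP -subr_gt0 mkN mkD lt_neqAle eq_sym; split.
- move=> /andP [n0]; rewrite -[_ <= _]/(quot_le _ _) quot_le0 => /asboolP [a [c e]].
  case: (zeroVsucc M a) => [a0|[k ek]]; last by exists k, c; apply/mk_eq; rewrite e ek.
  by case/eqP: n0; rewrite e a0; apply/mk_eq; rewrite /qeq /= !mul0m.
- move=> [a [c /mk_eq e]]; rewrite e; apply/andP; split.
    apply/eqP => /mk_eq; rewrite /qeq /= !(mul0m, addm0, add0m, mulmS, mulm0).
    exact: succ_neq0.
  by rewrite -[_ <= _]/(quot_le _ _) quot_le0; apply/asboolP; do 2 eexists.
Qed.

End Quotient.

(** * Codes of rationals *)

Section Codes.
Variable M : rca.
Notation D := (carrier M).

Definition mle (x y : D) : Prop := mlt M x y \/ x = y.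

Lemma mle_antisym x y : mle x y -> mle y x -> x = y.
Proof.
move=> [h|//] [h'|//]; case: (ltm_irr M x).
exact: ltm_trans h h'.
Qed.

Lemma mle_refl x : mle x x.
Proof. by right. Qed.

Lemma mle_trans y x z : mle x y -> mle y z -> mle x z.
Proof.
move=> [h|->] // [h'|<-]; [left|by left].
exact: ltm_trans h h'.
Qed.

Lemma not_lt_le x y : ~ mlt M y x -> mle x y.
Proof. by move=> n; case: (ltm_total M x y) => [|[]]; [left|right|move=> /n]. Qed.

Definition trip_code (f : trip M) : D :=
  mpair M (mpair M (tpos M f) (tneg M f)) (tden M f).

Lemma trip_code_inj f g : trip_code f = trip_code g -> f = g.
Proof. by case: f g => [a b c] [a' b' c'] /mpair_inj /= [/mpair_inj [-> ->] ->]. Qed.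

(* The canonical code of a rational, as in [is_rat]. *)
Definition is_code (q : D) (u : quot M) : Prop :=
  (exists g, mk M g = u /\ q = trip_code g) /\
  (forall g, mk M g = u -> mle q (trip_code g)).

Lemma code_exists u : exists q, is_code q u.
Proof.
have [f ->] := mk_surj M u.
pose P q := exists a, mlt M a (madd M q (mone M)) /\ exists b, mlt M b (madd M q (mone M)) /\
  exists c, mlt M c (madd M q (mone M)) /\ qeq M (Trip M a b c) f /\ q = trip_code (Trip M a b c).
have PE q : P q <-> exists g, qeq M g f /\ q = trip_code g.
{ split=> [[a [_ [b [_ [c [_ h]]]]]]|[[a b c] [h e]]]; first by exists (Trip M a b c).
  have tr x y z : mlt M x (madd M y (mone M)) -> mlt M y (madd M z (mone M)) -> mlt M x (madd M z (mone M)).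
    by move=> /ltmS [k|->] //; apply: ltm_trans k.
  have hl := lt_mpair_l M; have hr := lt_mpair_r M.
  exists a; split; first by rewrite e; apply: tr (hl _ _) (hl _ _).
  exists b; split; first by rewrite e; apply: tr (hr _ _) (hl _ _).
  by exists c; split=> //; rewrite e; apply: hr. }
have dP : Def1 M false P.
{ rewrite /P /trip_code /mpair /qeq /=; def. }
have [|q [Pq lq]] := Delta0_least M P (trip_code f) dP.
  by apply/PE; exists f; split=> //; apply: qeq_refl.
exists q; split.
  by have /PE [g [h e]] := Pq; exists g; split=> //; apply/mk_eq.
move=> g /mk_eq h; apply: not_lt_le => /lq; apply; apply/PE.
by exists g.
Qed.

Lemma code_unique q q' u : is_code q u -> is_code q' u -> q = q'.
Proof.
move=> [[g [h e]] l] [[g' [h' e']] l']; apply: mle_antisym.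
  by rewrite e'; apply: l.
by rewrite e; apply: l'.
Qed.

Definition rc (u : quot M) : D := sval (cid (code_exists u)).

Lemma rcP q u : is_code q u <-> q = rc u.
Proof.
have H : is_code (rc u) u by rewrite /rc; case: cid.
by split=> [/code_unique h|->] //; apply: h.
Qed.

Lemma rc_inj u v : rc u = rc v -> u = v.
Proof.
have /rcP [[g [<- ->]] _] : rc u = rc u by [].
have /rcP [[g' [<- ->]] _] : rc v = rc v by [].
by move=> /trip_code_inj ->.
Qed.

End Codes.

(** * Formulas with named variables *)

Section Semantics.
Variable M : rca.
Notation D := (carrier M).

(* The depths and environments at which a formula with named variables is read.
   [den c t x] asks that [t] denote [x] in [c] and below further quantifiers. *)
Record ctx : Type := Ctx { cd : nat; ce : nat; cs : nat -> D; cr : nat -> nat }.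

Definition pushn (x : D) (c : ctx) : ctx := Ctx (S (cd c)) (ce c) (scons x (cs c)) (cr c).
Definition pushs (X : nat) (c : ctx) : ctx := Ctx (cd c) (S (ce c)) (cs c) (scons X (cr c)).

Inductive ext (c : ctx) : ctx -> Prop :=
| ext_refl : ext c c
| ext_n x c' : ext c c' -> ext c (pushn x c')
| ext_s X c' : ext c c' -> ext c (pushs X c').

Lemma ext_trans c c' c'' : ext c c' -> ext c' c'' -> ext c c''.
Proof. by move=> h; elim=> //; [move=> *; apply: ext_n|move=> *; apply: ext_s]. Qed.

Lemma ext_cs c c' : ext c c' ->
  exists k, cd c' = k + cd c /\ forall n, cs c' (k + n) = cs c n.
Proof.
elim=> [|x c2 _ [k [e h]]|X c2 _ [k [e h]]].
- by exists 0.
- by exists (S k); rewrite /= e.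
- by exists k.
Qed.

Lemma ext_cr c c' : ext c c' ->
  exists k, ce c' = k + ce c /\ forall n, cr c' (k + n) = cr c n.
Proof.
elim=> [|x c2 _ [k [e h]]|X c2 _ [k [e h]]].
- by exists 0.
- by exists k.
- by exists (S k); rewrite /= e.
Qed.

Definition bsat (c : ctx) (p : bform) : Prop := sat M (cs c) (cr c) (p (cd c) (ce c)).
Definition den (c : ctx) (t : num) (x : D) : Prop :=
  forall c', ext c c' -> eval M (cs c') (t (cd c')) = x.
Definition sden (c : ctx) (X : svar) (Y : nat) : Prop :=
  forall c', ext c c' -> cr c' (X (ce c')) = Y.

Lemma den_ext c c' t x : ext c c' -> den c t x -> den c' t x.
Proof. by move=> h H c'' h'; apply: H; apply: ext_trans h'. Qed.

Lemma sden_ext c c' t x : ext c c' -> sden c t x -> sden c' t x.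
Proof. by move=> h H c'' h'; apply: H; apply: ext_trans h'. Qed.

Lemma den_pushn c t x y : den c t x -> den (pushn y c) t x.
Proof. by apply: den_ext; apply: ext_n; apply: ext_refl. Qed.

Lemma den_pushs c t x Y : den c t x -> den (pushs Y c) t x.
Proof. by apply: den_ext; apply: ext_s; apply: ext_refl. Qed.

Lemma sden_pushn c t x y : sden c t x -> sden (pushn y c) t x.
Proof. by apply: sden_ext; apply: ext_n; apply: ext_refl. Qed.

Lemma sden_pushs c t x Y : sden c t x -> sden (pushs Y c) t x.
Proof. by apply: sden_ext; apply: ext_s; apply: ext_refl. Qed.

Lemma den_bvar c x : den (pushn x c) (bvar (cd c)) x.
Proof.
move=> c' /ext_cs [k [e h]]; rewrite /bvar /= e /=.
have -> : k + S (cd c) - S (cd c) = k + 0 by rewrite PeanoNat.Nat.add_sub PeanoNat.Nat.add_0_r.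
by rewrite h.
Qed.

Lemma sden_bsvar c X : sden (pushs X c) (bsvar (ce c)) X.
Proof.
move=> c' /ext_cr [k [e h]]; rewrite /bsvar /= e /=.
have -> : k + S (ce c) - S (ce c) = k + 0 by rewrite PeanoNat.Nat.add_sub PeanoNat.Nat.add_0_r.
by rewrite h.
Qed.

Lemma den_zero c : den c bzero (mzero M). Proof. by []. Qed.
Lemma den_one c : den c bone (mone M). Proof. by []. Qed.
Lemma den_add c s t x y : den c s x -> den c t y -> den c (badd s t) (madd M x y).
Proof. by move=> h h' c' e; rewrite /= (h _ e) (h' _ e). Qed.
Lemma den_mul c s t x y : den c s x -> den c t y -> den c (bmul s t) (mmul M x y).
Proof. by move=> h h' c' e; rewrite /= (h _ e) (h' _ e). Qed.
Lemma den_pair c s t x y : den c s x -> den c t y -> den c (Defs.pair s t) (mpair M x y).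
Proof. by move=> h h'; do !(apply: den_add => // || apply: den_mul => //). Qed.

Lemma bsat_neg c p P : (bsat c p <-> P) -> (bsat c (bneg p) <-> ~ P).
Proof. by rewrite /bsat /=; tauto. Qed.
Lemma bsat_imp c p q P Q : (bsat c p <-> P) -> (bsat c q <-> Q) ->
  (bsat c (bimp p q) <-> (P -> Q)).
Proof. by rewrite /bsat /=; tauto. Qed.
Lemma bsat_and c p q P Q : (bsat c p <-> P) -> (bsat c q <-> Q) ->
  (bsat c (band p q) <-> P /\ Q).
Proof. by rewrite /bsat /=; tauto. Qed.
Lemma bsat_or c p q P Q : (bsat c p <-> P) -> (bsat c q <-> Q) ->
  (bsat c (bor p q) <-> P \/ Q).
Proof. by rewrite /bsat /=; tauto. Qed.
Lemma bsat_iff c p q P Q : (bsat c p <-> P) -> (bsat c q <-> Q) ->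
  (bsat c (biff p q) <-> (P <-> Q)).
Proof. by rewrite /bsat /=; tauto. Qed.
Lemma bsat_eq c s t x y : den c s x -> den c t y -> (bsat c (beq s t) <-> x = y).
Proof. by move=> h h'; rewrite /bsat /= (h _ (ext_refl _)) (h' _ (ext_refl _)). Qed.
Lemma bsat_lt c s t x y : den c s x -> den c t y -> (bsat c (blt s t) <-> mlt M x y).
Proof. by move=> h h'; rewrite /bsat /= (h _ (ext_refl _)) (h' _ (ext_refl _)). Qed.
Lemma bsat_le c s t x y : den c s x -> den c t y ->
  (bsat c (bor (blt s t) (beq s t)) <-> mle M x y).
Proof. by move=> h h'; apply: bsat_or; [apply: bsat_lt|apply: bsat_eq]. Qed.
Lemma bsat_mem c t X x Y : den c t x -> sden c X Y -> (bsat c (bmem t X) <-> mmem M x Y).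
Proof. by move=> h h'; rewrite /bsat /= (h _ (ext_refl _)) (h' _ (ext_refl _)). Qed.

Lemma bsat_all c f P : (forall x, bsat (pushn x c) (f (bvar (cd c))) <-> P x) ->
  (bsat c (ball f) <-> forall x, P x).
Proof. by move=> H; split=> h x; [apply/H; apply: h|apply: (iffRL (H x))]. Qed.
Lemma bsat_ex c f P : (forall x, bsat (pushn x c) (f (bvar (cd c))) <-> P x) ->
  (bsat c (bex f) <-> exists x, P x).
Proof. by move=> H; rewrite /bsat /bex sat_Ex; split=> -[x h]; exists x; apply/H. Qed.
Lemma bsat_sall c f P : (forall x, bsat (pushs x c) (f (bsvar (ce c))) <-> P x) ->
  (bsat c (bsall f) <-> forall x, P x).
Proof. by move=> H; split=> h x; [apply/H; apply: h|apply: (iffRL (H x))]. Qed.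
Lemma bsat_sex c f P : (forall x, bsat (pushs x c) (f (bsvar (ce c))) <-> P x) ->
  (bsat c (bsex f) <-> exists x, P x).
Proof.
move=> H; rewrite /bsat /bsex /SEx /=; split=> [h|[x /H h] h']; last exact: h' h.
by apply: NNPP => nh; apply: h => X h; apply: nh; exists X; apply/H.
Qed.

Definition fden_at (c : ctx) (F : frac) (f : trip M) : Prop :=
  den c (fpos F) (tpos M f) /\ den c (fneg F) (tneg M f) /\ den c (fden F) (tden M f).

Lemma fden_pushn c F f x : fden_at c F f -> fden_at (pushn x c) F f.
Proof. by move=> [h [h' h'']]; split; [|split]; apply: den_pushn. Qed.
Lemma fden_pushs c F f X : fden_at c F f -> fden_at (pushs X c) F f.
Proof. by move=> [h [h' h'']]; split; [|split]; apply: den_pushs. Qed.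
Lemma fden_zero c : fden_at c fzero (qzero M). Proof. by []. Qed.
Lemma fden_one c : fden_at c fone (qone M). Proof. by []. Qed.
Lemma fden_opp c F f : fden_at c F f -> fden_at c (fopp F) (qopp M f).
Proof. by move=> [h [h' h'']]. Qed.
Lemma fden_add c F G f g : fden_at c F f -> fden_at c G g ->
  fden_at c (fadd F G) (qadd M f g).
Proof.
move=> [h [h' h'']] [k [k' k'']]; split; [|split];
by do !(apply: den_add => // || apply: den_mul => //).
Qed.

Definition pushf (f : trip M) (c : ctx) : ctx :=
  pushn (tden M f) (pushn (tneg M f) (pushn (tpos M f) c)).
Definition frac_at (c : ctx) : frac :=
  Frac (bvar (cd c)) (bvar (S (cd c))) (bvar (S (S (cd c)))).

Lemma fden_bound c f : fden_at (pushf f c) (frac_at c) f.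
Proof.
split; [|split].
- by do 2 apply: den_pushn; apply: den_bvar.
- by apply: den_pushn; apply: (den_bvar (pushn _ c)).
- exact: (den_bvar (pushn _ (pushn _ c))).
Qed.

Lemma bsat_fall c F P : (forall f, bsat (pushf f c) (F (frac_at c)) <-> P f) ->
  (bsat c (fall F) <-> forall f, P f).
Proof.
move=> H; split=> [h f|h x y z]; first by apply/H; apply: h.
exact: (iffRL (H (Trip M x y z))).
Qed.
Lemma bsat_fex c F P : (forall f, bsat (pushf f c) (F (frac_at c)) <-> P f) ->
  (bsat c (fex F) <-> exists f, P f).
Proof.
move=> H; rewrite /bsat /fex /bex sat_Ex; split.
- move=> [x]; rewrite sat_Ex => -[y]; rewrite sat_Ex => -[z h].
  by exists (Trip M x y z); apply/H.
- move=> [[x y z] /H h]; exists x; rewrite sat_Ex; exists y; rewrite sat_Ex; exists z.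
  exact: h.
Qed.

Lemma bsat_feq c F G f g : fden_at c F f -> fden_at c G g ->
  (bsat c (feq F G) <-> mk M f = mk M g).
Proof.
move=> [h [h' h'']] [k [k' k'']]; rewrite mk_eq; apply: bsat_eq;
by do !(apply: den_add => // || apply: den_mul => //).
Qed.
Lemma bsat_flt c F G f g : fden_at c F f -> fden_at c G g ->
  (bsat c (flt F G) <-> (mk M f < mk M g)%R).
Proof.
move=> [h [h' h'']] [k [k' k'']]; rewrite mk_lt; apply: bsat_lt;
by do !(apply: den_add => // || apply: den_mul => //).
Qed.
Lemma den_fcode c F f : fden_at c F f -> den c (fcode F) (trip_code M f).
Proof. by move=> [h [h' h'']]; apply: den_pair => //; apply: den_pair. Qed.

End Semantics.

(** * Automation for evaluating formulas *)

Ltac solve_fden :=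
  first [ assumption | apply: fden_zero | apply: fden_one | apply: fden_bound
        | apply: fden_opp; solve_fden | apply: fden_add; solve_fden
        | apply: fden_pushn; solve_fden | apply: fden_pushs; solve_fden ].

Ltac solve_den :=
  first [ assumption | apply: den_zero | apply: den_one | apply: den_bvar
        | apply: den_pair; solve_den
        | apply: den_add; solve_den | apply: den_mul; solve_den
        | apply: den_fcode; solve_fden
        | apply: den_pushn; solve_den | apply: den_pushs; solve_den ].

Ltac solve_sden :=
  first [ assumption | apply: sden_bsvar
        | apply: sden_pushn; solve_sden | apply: sden_pushs; solve_sden ].

Ltac sem_atom :=
  first [ apply: bsat_le; solve_den | apply: bsat_eq; solve_den | apply: bsat_lt; solve_den
        | apply: bsat_mem; [solve_den|solve_sden]
        | apply: bsat_feq; solve_fden | apply: bsat_flt; solve_fden ].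

(** [tac] evaluates the notions already treated. It is tried first, so a formula is decomposed only
    down to these notions and not into their definitions. *)
Ltac sem_with tac :=
  first [ tac | sem_atom
  | apply: bsat_fall => ?; sem_with tac | apply: bsat_fex => ?; sem_with tac
  | apply: bsat_all => ?; sem_with tac | apply: bsat_ex => ?; sem_with tac
  | apply: bsat_sall => ?; sem_with tac | apply: bsat_sex => ?; sem_with tac
  | apply: bsat_iff; sem_with tac | apply: bsat_and; sem_with tac | apply: bsat_or; sem_with tac
  | apply: bsat_neg; sem_with tac | apply: bsat_imp; sem_with tac | idtac ].

(** * The cover principle in a model *)

Section Reals.
Variable M : rca.
Notation D := (carrier M).
Notation Q := (quot M).
Notation rc := (rc M).
Notation mle := (mle M).
Local Open Scope ring_scope.
Implicit Types (c : ctx M) (u v : Q).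

Lemma ex_mk (P : Q -> Prop) : (exists f, P (mk M f)) <-> exists u, P u.
Proof.
split=> [[f h]|[u]]; first by exists (mk M f).
by have [f ->] := mk_surj M u => h; exists f.
Qed.

Lemma bsat_is_rat c q F x f : den M c q x -> fden_at M c F f ->
  (bsat M c (is_rat q F) <-> x = rc (mk M f)).
Proof. by move=> hq hF; rewrite -rcP /is_code /is_rat; sem_with fail. Qed.

Lemma bsat_rat c q x : den M c q x -> (bsat M c (rat q) <-> exists u, x = rc u).
Proof.
move=> hq; rewrite -(ex_mk (fun u => x = rc u)); apply: bsat_fex => f.
by apply: bsat_is_rat; [solve_den|solve_fden].
Qed.

Ltac rat_atom := apply: bsat_is_rat; [solve_den|solve_fden].

Lemma bsat_rat_pos c q x : den M c q x ->
  (bsat M c (rat_pos q) <-> exists u, x = rc u /\ 0 < u).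
Proof.
by move=> hq; rewrite -(ex_mk (fun u => x = rc u /\ 0 < u)) /rat_pos; sem_with rat_atom.
Qed.

Lemma bsat_rat_lt c p q x y : den M c p x -> den M c q y ->
  (bsat M c (rat_lt p q) <-> exists u v, x = rc u /\ y = rc v /\ u < v).
Proof.
move=> hp hq; rewrite -(ex_mk (fun u => exists v, x = rc u /\ y = rc v /\ u < v)).
apply: bsat_fex => f; rewrite -(ex_mk (fun v => x = rc _ /\ y = rc v /\ _ < v)).
by sem_with rat_atom.
Qed.

Definition code_le (x y : D) : Prop :=
  (exists u v, x = rc u /\ y = rc v /\ u < v) \/ x = y.

Lemma code_le_rc u v : code_le (rc u) (rc v) <-> u <= v.
Proof.
rewrite le_eqVlt; split=> [[[u' [v' [/rc_inj -> [/rc_inj -> ->]]]]|/rc_inj ->]|/orP [/eqP ->|h]].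
- by rewrite orbT.
- by rewrite eqxx.
- by right.
- by left; exists u, v.
Qed.

Lemma bsat_rat_le c p q x y : den M c p x -> den M c q y ->
  (bsat M c (rat_le p q) <-> code_le x y).
Proof. by move=> hp hq; apply: bsat_or; [apply: bsat_rat_lt|apply: bsat_eq]. Qed.

Lemma bsat_rat_add c p q s x y z : den M c p x -> den M c q y -> den M c s z ->
  (bsat M c (rat_add p q s) <-> exists u v, x = rc u /\ y = rc v /\ z = rc (u + v)).
Proof.
move=> hp hq hs; rewrite -(ex_mk (fun u => exists v, x = rc u /\ y = rc v /\ z = rc (u + v))).
apply: bsat_fex => f; rewrite -(ex_mk (fun v => x = rc _ /\ y = rc v /\ z = rc (_ + v))).
by apply: bsat_fex => g; rewrite mkD; sem_with rat_atom.
Qed.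

Lemma bsat_rat_sub c p q s x y z : den M c p x -> den M c q y -> den M c s z ->
  (bsat M c (rat_sub p q s) <-> exists u v, x = rc u /\ y = rc v /\ z = rc (u - v)).
Proof.
move=> hp hq hs; rewrite -(ex_mk (fun u => exists v, x = rc u /\ y = rc v /\ z = rc (u - v))).
apply: bsat_fex => f; rewrite -(ex_mk (fun v => x = rc _ /\ y = rc v /\ z = rc (_ - v))).
by apply: bsat_fex => g; rewrite mkN mkD; sem_with rat_atom.
Qed.

Lemma bsat_rat_abs c p s x z : den M c p x -> den M c s z ->
  (bsat M c (rat_abs p s) <-> exists u, x = rc u /\ z = rc `|u|).
Proof.
move=> hp hs; rewrite -(ex_mk (fun u => x = rc u /\ z = rc `|u|)).
apply: bsat_fex => f; apply: bsat_and; first by rat_atom.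
have E : (mk M f < 0 /\ z = rc (- mk M f)) \/ (~ mk M f < 0 /\ z = rc (mk M f)) <-> z = rc `|mk M f|.
{ case: (ltrP (mk M f) 0) => h; [rewrite ltr0_norm //|rewrite ger0_norm //].
  - by split=> [[[]|[]]//|->]; left.
  - by split=> [[[]|[]]//|->]; right. }
by rewrite -E mkN; sem_with rat_atom.
Qed.

(** All extensions of [c] are considered because a [ratseq] is read below the quantifiers of the
    formulas built from it. *)
Definition seqd c (x : ratseq) (xs : D -> Q) : Prop :=
  forall c' n q nv qv, ext M c c' -> den M c' n nv -> den M c' q qv ->
  (bsat M c' (x n q) <-> qv = rc (xs nv)).

Definition graph (X : nat) (xs : D -> Q) : Prop :=
  forall k, mmem M k X <-> exists n, k = mpair M n (rc (xs n)).

Lemma graph_mem X xs n q : graph X xs -> (mmem M (mpair M n q) X <-> q = rc (xs n)).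
Proof.
by move=> ->; split=> [[m /mpair_inj [-> ->]]|->] //; exists n.
Qed.

Lemma seqd_set c X Xv xs : sden M c X Xv -> graph Xv xs -> seqd c (seq_set X) xs.
Proof.
move=> hX gX c' n q nv qv h hn hq; rewrite -(graph_mem _ _ _ _ gX).
by apply: bsat_mem; [solve_den|apply: sden_ext hX].
Qed.

Lemma seqd_rat c a u : den M c a (rc u) -> seqd c (seq_rat a) (fun _ => u).
Proof.
move=> ha c' n q nv qv h hn hq.
by apply: bsat_eq => //; apply: den_ext ha.
Qed.

Lemma seqd_frac c F f : fden_at M c F f -> seqd c (seq_frac F) (fun _ => mk M f).
Proof.
move=> [h1 [h2 h3]] c' n q nv qv h hn hq; apply: bsat_is_rat => //.
by split; [|split]; apply: den_ext h _.
Qed.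

Ltac seq_atom := match goal with H : seqd _ ?x _ |- context [bsat _ _ (?x _ _)] =>
  apply: H; [repeat first [assumption | apply: ext_refl | apply: ext_n | apply: ext_s]
   | solve_den | solve_den] end.

Lemma seqd_sub c x y xs ys : seqd c x xs -> seqd c y ys ->
  seqd c (seq_sub x y) (fun n => xs n - ys n).
Proof.
move=> hx hy c' n q nv qv h hn hq; rewrite /seq_sub.
(* [B] is the literal reading of the formula, which [sem_with] verifies; what remains is its
   simplification over [quot M]. Several evaluation lemmas below follow this scheme. *)
apply: (iff_trans (B := exists p' q', p' = rc (xs nv) /\ q' = rc (ys nv) /\
  exists u v, p' = rc u /\ q' = rc v /\ qv = rc (u - v))).
  by sem_with ltac:(first [seq_atom | apply: bsat_rat_sub; solve_den]).
split=> [[p' [q' [-> [-> [u [v [/rc_inj -> [/rc_inj -> ->]]]]]]]] //|->].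
by exists (rc (xs nv)), (rc (ys nv)); do 2 split=> //; exists (xs nv), (ys nv).
Qed.

Lemma seqd_abs c x xs : seqd c x xs -> seqd c (seq_abs x) (fun n => `|xs n|).
Proof.
move=> hx c' n q nv qv h hn hq; rewrite /seq_abs.
apply: (iff_trans (B := exists p', p' = rc (xs nv) /\ exists u, p' = rc u /\ qv = rc `|u|)).
  by sem_with ltac:(first [seq_atom | apply: bsat_rat_abs; solve_den]).
split=> [[p' [-> [u [/rc_inj -> ->]]]] //|->].
by exists (rc (xs nv)); split=> //; exists (xs nv).
Qed.

Definition eventually (P : D -> Prop) : Prop := exists N, forall n, mle N n -> P n.

Definition seq_le (xs ys : D -> Q) : Prop :=
  forall e, 0 < e -> eventually (fun n => xs n <= ys n + e).

Lemma bsat_real_le c x y xs ys : seqd c x xs -> seqd c y ys ->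
  (bsat M c (real_le x y) <-> seq_le xs ys).
Proof.
move=> hx hy.
apply: (iff_trans (B := forall eps, (exists u, eps = rc u /\ 0 < u) ->
  exists N, forall n, mle N n -> forall p q, p = rc (xs n) ->
  (exists p' q', p' = rc (ys n) /\ q' = eps /\
    exists u v, p' = rc u /\ q' = rc v /\ q = rc (u + v)) -> code_le p q)).
  by rewrite /real_le /seq_add /seq_rat; sem_with ltac:(first [seq_atom
    | apply: bsat_rat_pos; solve_den | apply: bsat_rat_le; solve_den
    | apply: bsat_rat_add; solve_den]).
split=> h e.
- move=> e0; have [|N hN] := h (rc e); first by exists e.
  exists N => n /hN /(_ (rc (xs n)) (rc (ys n + e)) erefl) H.
  by apply/code_le_rc/H; exists (rc (ys n)), (rc e); do 2 split=> //; exists (ys n), e.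
- move=> [u [-> u0]]; have [N hN] := h u u0; exists N => n /hN H p q ->.
  move=> [p' [q' [-> [-> [v [w [/rc_inj <- [/rc_inj <- ->]]]]]]]].
  exact/code_le_rc.
Qed.

Lemma bsat_real_lt c x y xs ys : seqd c x xs -> seqd c y ys ->
  (bsat M c (real_lt x y) <-> seq_le xs ys /\ ~ (seq_le xs ys /\ seq_le ys xs)).
Proof. by move=> hx hy; rewrite /real_lt /real_eq; sem_with ltac:(apply: bsat_real_le; assumption). Qed.

Definition cauchy (xs : D -> Q) : Prop := forall e, 0 < e ->
  exists N, forall m n, mle N m -> mle N n -> `|xs m - xs n| < e.

Lemma bsat_function_to c X Xv (C : num -> bform) (P : D -> Prop) : sden M c X Xv ->
  (forall c' q x, ext M c c' -> den M c' q x -> (bsat M c' (C q) <-> P x)) ->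
  (bsat M c (function_to C X) <->
   (forall k, mmem M k Xv -> exists n q, k = mpair M n q /\ P q) /\
   (forall n, exists q, mmem M (mpair M n q) Xv /\
     forall q', mmem M (mpair M n q') Xv -> q' = q)).
Proof.
move=> hX hC; rewrite /function_to.
by sem_with ltac:(apply: hC; [repeat first [apply: ext_refl | apply: ext_n]|solve_den]).
Qed.

Lemma bsat_real c X Xv : sden M c X Xv ->
  (bsat M c (real X) <-> exists xs, graph Xv xs /\ cauchy xs).
Proof.
move=> hX.
apply: (iff_trans (B := ((forall k, mmem M k Xv -> exists n q, k = mpair M n q /\ exists u, q = rc u) /\
   (forall n, exists q, mmem M (mpair M n q) Xv /\
     forall q', mmem M (mpair M n q') Xv -> q' = q)) /\
  forall eps, (exists u, eps = rc u /\ 0 < u) -> exists N, forall m n, mle N m -> mle N n ->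
    forall p q s t, mmem M (mpair M m p) Xv -> mmem M (mpair M n q) Xv ->
    (exists u v, p = rc u /\ q = rc v /\ s = rc (u - v)) -> (exists u, s = rc u /\ t = rc `|u|) ->
    (exists u v, t = rc u /\ eps = rc v /\ u < v))).
  rewrite /real; apply: bsat_and.
    by apply: bsat_function_to => // c' q x _; apply: bsat_rat.
  by sem_with ltac:(first [apply: bsat_rat_pos; solve_den | apply: bsat_rat_sub; solve_den
    | apply: bsat_rat_abs; solve_den | apply: bsat_rat_lt; solve_den]).
split.
- move=> [[hg hf] hc].
  have H n : exists u, mmem M (mpair M n (rc u)) Xv.
    have [q [hq _]] := hf n; have [n' [q' [/mpair_inj [_ <-] [u e]]]] := hg _ hq.
    by exists u; rewrite -e.
  (* The sequence is chosen outside the model; [graph] ties it to the set that codes it. *)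
  pose xs n := sval (cid (H n)).
  have hxs n : mmem M (mpair M n (rc (xs n))) Xv by rewrite /xs; case: cid.
  exists xs; split.
    move=> k; split=> [hk|[n ->]] //.
    have [n [q [e _]]] := hg _ hk; exists n; rewrite e; congr mpair.
    have [q' [_ u]] := hf n; rewrite (u _ (hxs n)); apply: u.
    by rewrite -e.
  move=> e e0; have [|N hN] := hc (rc e); first by exists e.
  exists N => m n lm ln.
  have [||u [v [/rc_inj -> [/rc_inj ->]]]] // := hN m n lm ln _ _ (rc (xs m - xs n)) (rc `|xs m - xs n|) (hxs m) (hxs n).
    by exists (xs m), (xs n).
  by exists (xs m - xs n).
- move=> [xs [gX cX]]; have gm := fun n q => graph_mem Xv xs n q gX; split; first split.
  + by move=> k /gX [n ->]; exists n, (rc (xs n)); split=> //; exists (xs n).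
  + by move=> n; exists (rc (xs n)); split=> [|q']; [apply/gm|move=> /gm].
  + move=> _ [e [-> e0]]; have [N hN] := cX e e0; exists N => m n lm ln p q s t.
    move=> /gm -> /gm -> [u [v [/rc_inj <- [/rc_inj <- ->]]]] [w [/rc_inj <- ->]].
    by do 2 eexists; split; [reflexivity|split; [reflexivity|apply: hN]].
Qed.

Definition in_unit (xs : D -> Q) : Prop :=
  cauchy xs /\ seq_le (fun _ => 0) xs /\ seq_le xs (fun _ => 1).

Lemma bsat_in_unit_interval c X Xv : sden M c X Xv ->
  (bsat M c (in_unit_interval X) <-> exists xs, graph Xv xs /\ in_unit xs).
Proof.
move=> hX; have E xs : graph Xv xs ->
    (bsat M c (band (real_le (seq_frac fzero) (seq_set X)) (real_le (seq_set X) (seq_frac fone)))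
     <-> seq_le (fun _ => 0) xs /\ seq_le xs (fun _ => 1)).
  move=> gX; have hs := seqd_set _ _ _ _ hX gX.
  apply: bsat_and; apply: bsat_real_le => //.
    exact: (seqd_frac c fzero _ (fden_zero M c)).
  exact: (seqd_frac c fone _ (fden_one M c)).
apply: (iff_trans (bsat_and M c _ _ _ _ (bsat_real _ _ _ hX) (iff_refl _))).
split=> [[[xs [gX cX]] /(E _ gX) h]|[xs [gX [cX h]]]]; first by exists xs.
by split; [exists xs|apply/(E _ gX)].
Qed.

Definition ball_mem (xs : D -> Q) (a r : Q) : Prop :=
  seq_le (fun n => `|a - xs n|) (fun _ => r) /\
  ~ (seq_le (fun n => `|a - xs n|) (fun _ => r) /\ seq_le (fun _ => r) (fun n => `|a - xs n|)).

Lemma bsat_in_ball c X Xv xs a r u v : sden M c X Xv -> graph Xv xs ->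
  den M c a (rc u) -> den M c r (rc v) ->
  (bsat M c (in_ball X a r) <-> ball_mem xs u v).
Proof.
move=> hX gX ha hr; apply: (bsat_real_lt _ _ _ (fun n => `|u - xs n|) (fun _ => v)).
  by apply: seqd_abs; apply: seqd_sub; [apply: seqd_rat|apply: seqd_set hX gX].
exact: seqd_rat.
Qed.

Definition elt (n i m : D) (u v : Q) : D :=
  mpair M (mpair M n i) (mpair M m (mpair M (rc u) (rc v))).

Definition open_mem (U : nat) (n i : D) (xs : D -> Q) : Prop :=
  exists N u v, 0 < v /\ ball_mem xs u v /\ forall m, mle N m -> mmem M (elt n i m u v) U.

Lemma bsat_in_open c X Xv xs U Uv n i nv iv : sden M c X Xv -> graph Xv xs ->
  sden M c U Uv -> den M c n nv -> den M c i iv ->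
  (bsat M c (in_open X U n i) <-> open_mem Uv nv iv xs).
Proof.
move=> hX gX hU hn hi.
apply: (iff_trans (B := exists N a r, (exists u, a = rc u) /\ (exists v, r = rc v /\ 0 < v) /\
  bsat M (pushn M r (pushn M a (pushn M N c)))
    (in_ball X (bvar (S (cd _ c))) (bvar (S (S (cd _ c))))) /\
  forall m, mle N m -> mmem M (mpair M (mpair M nv iv) (mpair M m (mpair M a r))) Uv)).
  by rewrite /in_open /family_elt; sem_with ltac:(first [apply: bsat_rat_pos; solve_den
    | apply: bsat_rat; solve_den | match goal with |- bsat _ _ (in_ball _ _ _) <-> _ => exact: iff_refl end]).
have B N u v : bsat M (pushn M (rc v) (pushn M (rc u) (pushn M N c)))
    (in_ball X (bvar (S (cd _ c))) (bvar (S (S (cd _ c))))) <-> ball_mem xs u v.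
  by apply: (bsat_in_ball _ _ Xv); first [solve_sden | exact: gX | solve_den].
split.
- move=> [N [a [r [[u ->] [[v [-> v0]] [/B h h']]]]]].
  by exists N, u, v.
- move=> [N [u [v [v0 [h h']]]]]; exists N, (rc u), (rc v).
  by split; [exists u|split; [exists v|split; [apply/B|]]].
Qed.

Definition is_function (H : nat) : Prop :=
  (forall k, mmem M k H -> exists n q, k = mpair M n q) /\
  (forall n, exists q, mmem M (mpair M n q) H /\ forall q', mmem M (mpair M n q') H -> q' = q).

Definition heine_borel : Prop := forall U,
  (forall k, mmem M k U -> exists n i m u v, k = elt n i m u v /\ 0 < v) ->
  (forall n X xs, graph X xs -> in_unit xs -> exists i, open_mem U n i xs) ->
  exists H, is_function H /\ forall n k, mmem M (mpair M n k) H ->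
    forall X xs, graph X xs -> in_unit xs -> exists i, mle i k /\ open_mem U n i xs.

Lemma sat_heine_borel s r : sat M s r uniform_heine_borel <-> heine_borel.
Proof.
have O c U Uv : sden M c U Uv -> bsat M c (open_family U) <->
    forall k, mmem M k Uv -> exists n i m u v, k = elt n i m u v /\ 0 < v.
{ move=> hU; apply: (iff_trans (B := forall k, mmem M k Uv -> exists n i m a r,
    k = mpair M (mpair M n i) (mpair M m (mpair M a r)) /\ (exists u, a = rc u) /\
    exists v, r = rc v /\ 0 < v)).
    by rewrite /open_family /family_elt; sem_with ltac:(first [apply: bsat_rat_pos; solve_den
    | apply: bsat_rat; solve_den]).
  split=> h k /h [n [i [m]]].
  - by move=> [a [b [-> [[u ->] [v [-> v0]]]]]]; exists n, i, m, u, v.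
  - by move=> [u [v [-> v0]]]; exists n, i, m, (rc u), (rc v); split=> //; split; [exists u|exists v]. }
have I c X Xv U n (P : num -> bform) Uv nv (R : D -> Prop) :
    sden M c X Xv -> sden M c U Uv -> den M c n nv ->
    (forall i, bsat M (pushn M i c) (P (bvar (cd _ c))) <-> R i) ->
    (bsat M c (bimp (in_unit_interval X) (bex (fun i => band (P i) (in_open X U n i)))) <->
     forall xs, graph Xv xs -> in_unit xs -> exists i, R i /\ open_mem Uv nv i xs).
{ move=> hX hU hn hP.
  apply: (iff_trans (bsat_imp M c _ _ _ _ (bsat_in_unit_interval _ _ _ hX) (iff_refl _))).
  have E xs : graph Xv xs -> bsat M c (bex (fun i => band (P i) (in_open X U n i))) <->
      exists i, R i /\ open_mem Uv nv i xs.
    move=> gX; apply: bsat_ex => i; apply: bsat_and => //.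
    by apply: (bsat_in_open _ _ Xv); first [exact: gX | solve_sden | solve_den].
  split=> h; first by move=> xs gX uX; apply/(E _ gX); apply: h; exists xs.
  by move=> [xs [gX uX]]; apply/(E _ gX); apply: h. }
pose c := Ctx M 0 0 s r.
change (bsat M c (bsall (fun U => bimp (open_family U) (bimp
  (ball (fun n => bsall (fun X => bimp (in_unit_interval X) (bex (fun i => in_open X U n i)))))
  (bsex (fun H => band (function_to (fun k => beq k k) H) (ball (fun n => ball (fun k =>
     bimp (bmem (Defs.pair n k) H) (bsall (fun X => bimp (in_unit_interval X) (bex (fun i =>
       band (bor (blt i k) (beq i k)) (in_open X U n i))))))))))))) <-> heine_borel).
apply: bsat_sall => U; apply: bsat_imp; first by apply: O; solve_sden.
apply: bsat_imp.
- apply: bsat_all => n; apply: bsat_sall => X.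
  apply: (iff_trans (bsat_imp M _ _ _ _ _ (bsat_in_unit_interval _ _ X _) (iff_refl _))).
    by solve_sden.
  have E xs : graph X xs -> bsat M (pushs M X (pushn M n (pushs M U c)))
      (bex (fun i => in_open (bsvar 1) (bsvar 0) (bvar 0) i)) <->
      exists i, open_mem U n i xs.
    move=> gX; apply: bsat_ex => i.
    by apply: (bsat_in_open _ _ X); first [exact: gX | solve_sden | solve_den].
  split=> h; first by move=> xs gX uX; apply/(E _ gX); apply: h; exists xs.
  by move=> [xs [gX uX]]; apply/(E _ gX); apply: h.
- apply: bsat_sex => H; apply: bsat_and.
  { apply: (iff_trans (bsat_function_to _ _ H _ (fun _ => True) _ _)).
    + by solve_sden.
    + by move=> c' q x _ hq; split=> // _; apply/(bsat_eq M c' q q x x) => //.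
    + rewrite /is_function; split=> -[h1 h2]; split=> // k /h1.
        by move=> [n [q [e _]]]; exists n, q.
      by move=> [n [q e]]; exists n, q. }
  apply: bsat_all => n; apply: bsat_all => k; apply: bsat_imp; first by sem_atom.
  apply: bsat_sall => X; apply: (I _ _ X _ _ (fun i => bor (blt i (bvar 1)) (beq i (bvar 1))));
    first [solve_sden | solve_den | by move=> i; apply: bsat_le; solve_den].
Qed.

End Reals.

Lemma norm_cases (R : realDomainType) (x : R) :
  (0 <= x /\ `|x| = x \/ x < 0 /\ `|x| = - x)%R.
Proof.
by case: (lerP 0%R x) => h; [left; rewrite ger0_norm|right; rewrite ltr0_norm].
Qed.

Ltac norm_lra :=
  repeat match goal with |- context [Num.norm ?x] =>
    case: (norm_cases _ x) => -[? ->] end; lra.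

(** * From covers to arithmetical comprehension *)

Section Sequences.
Variable M : rca.
Notation D := (carrier M).
Notation Q := (quot M).
Notation mle := (mle M).
Local Open Scope ring_scope.

Lemma mle_max (x y : D) : exists z, mle x z /\ mle y z.
Proof.
case: (ltm_total M x y) => [h|[->|h]].
- by exists y; split; [left|right].
- by exists y; split; right.
- by exists x; split; [right|left].
Qed.

Lemma leS_mle (x y : D) : mlt M x (madd M y (mone M)) <-> mle x y.
Proof. exact: ltmS. Qed.

Lemma eventually_and (P R : D -> Prop) :
  eventually M P -> eventually M R -> eventually M (fun n => P n /\ R n).
Proof.
move=> [N hN] [K hK]; have [L [lN lK]] := mle_max N K; exists L => n ln.
by split; [apply: hN|apply: hK]; apply: mle_trans ln.
Qed.

Lemma eventually_ex (P : D -> Prop) : eventually M P -> exists n, P n.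
Proof. by move=> [N hN]; exists N; apply: hN; apply: mle_refl. Qed.

Lemma eventually_sub (P R : D -> Prop) : (forall n, P n -> R n) ->
  eventually M P -> eventually M R.
Proof. by move=> h [N hN]; exists N => n /hN /h. Qed.

(** Failure of equality only yields some [e] and arbitrarily late [n] with [|a - xs n| + e < r]. The
    Cauchy property at [e/2] extends this to all late indices and costs half of the margin. *)
Lemma ball_mem_margin xs (a r : Q) : cauchy M xs ->
  (ball_mem M xs a r <-> exists e, 0 < e /\ eventually M (fun n => `|a - xs n| + e <= r)).
Proof.
move=> cX; split.
- move=> [h1 h2].
  have [e [e0 he]] : exists e, 0 < e /\ ~ eventually M (fun n => r <= `|a - xs n| + e).
    apply: NNPP => H; apply: h2; split=> // e e0; apply: NNPP => h; apply: H.
    by exists e.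
  have [|N hN] := cX (e / 2%:R); first by lra.
  have [n [ln hn]] : exists n, mle N n /\ ~ r <= `|a - xs n| + e.
    apply: NNPP => H; apply: he; exists N => n ln; apply: NNPP => h; apply: H.
    by exists n.
  exists (e / 2%:R); split; first by lra.
  exists N => m lm; have := hN n m ln lm; move/negP: hn; rewrite -ltNge.
  by move: (xs n) (xs m) => x y; norm_lra.
- move=> [e [e0 he]]; split.
    by move=> d d0; apply: eventually_sub he => n; lra.
  move=> [_ h]; have e2 : 0 < e / 2%:R by lra.
  by have [n] := eventually_ex _ (eventually_and _ _ he (h _ e2)); lra.
Qed.

End Sequences.

Section Reversal.
Variable M : rca.
Notation D := (carrier M).
Notation mle := (mle M).
Local Open Scope ring_scope.

Lemma in_unit_ball xs : in_unit M xs -> ball_mem M xs 0 2%:R.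
Proof.
(* Eventually [xs n] lies between -1/4 and 5/4, so 1/2 is a margin below the radius 2. *)
move=> [cX [h0 h1]]; apply/ball_mem_margin => //; exists (2%:R^-1); split; first by lra.
have e0 : (0 : quot M) < 4%:R^-1 by lra.
apply: eventually_sub (eventually_and _ _ _ (h0 _ e0) (h1 _ e0)) => n [].
by move: (xs n) => x; norm_lra.
Qed.

(** Supplies a coded point of the unit interval at which the finite subcover can be tested: its
    membership forces some [U_ni] to be nonempty. *)
Lemma graph_zero : exists X, graph M X (fun _ => 0).
Proof.
have [X hX] : exists X, forall k, mmem M k X <-> exists n,
    mlt M n (madd M k (mone M)) /\ k = mpair M n (rc M 0).
  by move: (rc M 0) => z; apply: Delta0_CA; rewrite /mpair; def.
exists X => k; rewrite hX; split=> [[n [_ ->]]|[n ->]]; first by exists n.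
by exists n; split=> //; apply: lt_mpair_l.
Qed.

Lemma in_unit_zero : in_unit M (fun _ => 0).
Proof.
by split=> [e e0|]; [exists (mzero M) => *; rewrite subr0 normr0|
  split=> e e0; exists (mzero M) => *; lra].
Qed.

Lemma heine_borel_Sigma1_CA (phi : D -> D -> Prop) : heine_borel M ->
  Def2 M false phi -> exists Y, forall n, mmem M n Y <-> exists y, phi n y.
Proof.
move=> HB dphi.
pose S (n i m : D) := (exists y, mlt M y (madd M i (mone M)) /\ phi n y) \/
  (forall y, mlt M y (madd M m (mone M)) -> ~ phi n y).
have [U hU] : exists U, forall k, mmem M k U <-> exists n i m,
    k = elt M n i m 0 2%:R /\ S n i m.
{ rewrite /elt; move: (mpair M (rc M 0) (rc M 2%:R)) => c.
  have [U hU] := Delta0_CA M (fun k => exists n, mlt M n (madd M k (mone M)) /\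
    exists i, mlt M i (madd M k (mone M)) /\ exists m, mlt M m (madd M k (mone M)) /\
    (k = mpair M (mpair M n i) (mpair M m c) /\ S n i m)) ltac:(rewrite /mpair /S; def).
  exists U => k; rewrite hU; split.
    by move=> [n [_ [i [_ [m [_ h]]]]]]; exists n, i, m.
  have tr x y z : mlt M x (madd M y (mone M)) -> mlt M y (madd M z (mone M)) ->
      mlt M x (madd M z (mone M)).
    by move=> /leS_mle h /leS_mle h'; apply/leS_mle; apply: mle_trans h'.
  move=> [n [i [m [e h]]]]; exists n; split.
    by rewrite e; apply: tr (lt_mpair_l _ _ _) (lt_mpair_l _ _ _).
  exists i; split; first by rewrite e; apply: tr (lt_mpair_r _ _ _) (lt_mpair_l _ _ _).
  by exists m; split=> //; rewrite e; apply: tr (lt_mpair_l _ _ _) (lt_mpair_r _ _ _). }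
have [||H [[H1 H2] H3]] := HB U.
{ by move=> k /hU [n [i [m [-> _]]]]; exists n, i, m, 0, 2%:R; split=> //; lra. }
{ move=> n X xs _ uX; have bX := in_unit_ball xs uX.
  have [[y hy]|nphi] := EM (exists y, phi n y).
  + exists y, (mzero M), 0, 2%:R; split; first by lra.
    split=> // m _; apply/hU; exists n, y, m; split=> //; left.
    by exists y; split=> //; apply/leS_mle; right.
  + exists (mzero M), (mzero M), 0, 2%:R; split; first by lra.
    split=> // m _; apply/hU; exists n, (mzero M), m; split=> //; right.
    by move=> y _ h; apply: nphi; exists y. }
have bound n k y : mmem M (mpair M n k) H -> phi n y ->
    exists y', mlt M y' (madd M k (mone M)) /\ phi n y'.
{ move=> /H3 h hy; have [X gX] := graph_zero.
  have [i [lik [N [u [v [_ [_ h']]]]]]] := h X _ gX in_unit_zero.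
  (* A stage past both [N] and the witness [y] excludes the second disjunct of [S], so the first one
     gives a witness that is at most [i], hence at most [k]. *)
  have [m [lN ly]] := mle_max M N y.
  have /hU [n' [i' [m' [/mpair_inj [/mpair_inj [<- <-] /mpair_inj [<- _]] [[y' [ly' hy']]|nphi]]]]] := h' m lN.
    exists y'; split=> //; apply/leS_mle; apply: mle_trans lik.
    exact/leS_mle.
  by case: (nphi y) => //; apply/leS_mle. }
(* As [H] is total and its values bound witnesses, a bounded search below some value of [H] at [n]
   succeeds exactly if the search below every value does; this gives the Sigma-1 and the Pi-1
   form. *)
have [Y hY] := Delta1_CA M
  (fun n k => mmem M (mpair M n k) H /\ exists y, mlt M y (madd M k (mone M)) /\ phi n y)
  (fun n k => mmem M (mpair M n k) H -> exists y, mlt M y (madd M k (mone M)) /\ phi n y)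
  ltac:(rewrite /mpair; def) ltac:(rewrite /mpair; def)
  ltac:(by move=> n; split=> [[k [_ [y [_ hy]]]] k' hk'|h];
    [apply: bound hk' hy|have [k [hk _]] := H2 n; exists k; split=> //; apply: h]).
exists Y => n; rewrite hY; split=> [[k [_ [y [_ hy]]]]|[y hy]]; first by exists y.
by have [k [hk _]] := H2 n; exists k; split=> //; apply: bound hk hy.
Qed.

(* Pairing packs the parameters [e] and [z] into the single number [g (e, z)]. *)
Lemma code_parameters k : forall (P : env M k -> D -> D -> Prop),
  Def M false (S (S k)) (fun e => P e.1.1 e.1.2 e.2) ->
  exists g P', TermDef M (S k) g /\ Def2 M false P' /\
    forall e z y, P e z y <-> P' (g (e, z)) y.
Proof.
elim: k => [|k IH] P hP.
  exists (fun e => e.2), (P tt); split; [term_def|split].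
    by apply: def_ext hP => -[[[] z] y].
  by case.
have [|g [P' [hg [hP' E]]]] := IH (fun e w y =>
  exists x, mlt M x (madd M w (mone M)) /\ exists z, mlt M z (madd M w (mone M)) /\
  (w = mpair M x z /\ P (e, x) z y)).
  rewrite /mpair; do 3 def_step; first by def.
  apply: (def_sub _ _ _ (S (S (S k))) (fun e => P e.1.1 e.1.2 e.2)
    (fun e : env M (S (S (S (S k)))) => (e.1.1.1.1, e.1.2, e.2, e.1.1.2)) hP).
  do 3 (apply: envdef_pair; last by term_def).
  exact: envdef_fst (envdef_fst _ _ _ _ (envdef_fst _ _ _ _ (envdef_fst _ _ _ _ (envdef_id M k)))).
exists (fun e => g (e.1.1, mpair M e.1.2 e.2)), P'; split; last first.
  split=> // -[e x] z y; rewrite -E /=; split.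
    move=> h; exists x; split; first exact: lt_mpair_l.
    by exists z; split=> //; apply: lt_mpair_r.
  by move=> [x' [_ [z' [_ [/mpair_inj [<- <-] h]]]]].
apply: term_sub hg _; apply: envdef_pair; last by rewrite /mpair; term_def.
exact: envdef_fst (envdef_fst _ _ _ _ (envdef_id M k)).
Qed.

(** With the parameters packed into one number, comprehension yields a set, and membership in it is
    atomic: the unbounded quantifier has become a bounded formula with a set parameter. *)
Lemma heine_borel_bounded_ex k (P : env M k -> D -> Prop) : heine_borel M ->
  Def M false (S k) (fun e => P e.1 e.2) -> Def M false k (fun e => exists y, P e y).
Proof.
move=> HB hP.
(* The dummy parameter, set to 0 below, provides a number to start from when [k] is 0 and the
   environment is empty. *)
have [|g [P' [hg [hP' E]]]] := code_parameters k (fun e _ y => P e y).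
  refine (def_sub M false (S (S k)) (S k) (fun e => P e.1 e.2)
    (fun e : env M (S (S k)) => (e.1.1, e.2)) hP _).
  apply: envdef_pair; last by term_def.
  exact: envdef_fst (envdef_fst _ _ _ _ (envdef_id M k)).
have [Y hY] := heine_borel_Sigma1_CA P' HB hP'.
apply: (def_ext _ _ _ (fun e => mmem M (g (e, mzero M)) Y)).
  by move=> e; rewrite hY; split=> -[y h]; exists y; apply/(E e (mzero M)).
apply: def_mem; apply: term_sub hg _; apply: envdef_pair; first exact: envdef_id.
exact: term_const.
Qed.

Lemma heine_borel_bounded p : heine_borel M -> arithmetical p ->
  forall k, Def M false k (fun e => satid M (asg M k e) p).
Proof.
move=> HB; elim: p => [|p IHp q IHq|t u|t u|t X|p IH|//] /=.
- by move=> _ k; apply: def_const.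
- by move=> [/IHp hp /IHq hq] k; apply: def_imp.
- by move=> _ k; exists (Defs.Eq t u); split=> //; apply: bounded_Eq.
- by move=> _ k; exists (Defs.Lt t u); split=> //; apply: bounded_Lt.
- by move=> _ k; exists (Defs.Mem t X); split=> //; apply: bounded_Mem.
- move=> /IH h k.
  apply: (def_ext _ _ _ (fun e => ~ exists x, ~ satid M (scons x (asg M k e)) p)).
    move=> e; split=> [H x|H [x]]; last by apply; apply: H.
    by apply: NNPP => nh; apply: H; exists x.
  apply: def_not; apply: heine_borel_bounded_ex => //; apply: def_not.
  exact: (h (S k)).
Qed.

Lemma heine_borel_comprehension p : heine_borel M -> arithmetical p ->
  satid M (names M) (comprehension p).
Proof.
move=> HB ap; have hp := heine_borel_bounded p HB ap 1%nat.
have [X hX] := Delta0_CA M (fun x => satid M (asg M 1 (tt, x)) p) ltac:(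
  by apply: def_ext hp => -[[] x]).
rewrite /satid /comprehension /= => H; apply: (H X) => x.
have := hX x; rewrite sat_fsubst /=.
have -> : (fun n => scons x (names M) n) = scons x (names M) by [].
by rewrite /satid /=; tauto.
Qed.

End Reversal.

(** * From arithmetical comprehension to covers *)

Section RationalDefinability.
Variable M : rca.
Notation D := (carrier M).
Notation Q := (quot M).
Local Open Scope ring_scope.

(** A rational is a class of triples and not a number of the model, so definability is asked of the
    entries of one presentation. *)
Definition QDef k (F : env M k -> Q) : Prop :=
  exists a b c, TermDef M k a /\ TermDef M k b /\ TermDef M k c /\
  forall e, F e = mk M (Trip M (a e) (b e) (c e)).

Lemma qdef_mk k a b c : TermDef M k a -> TermDef M k b -> TermDef M k c ->
  QDef k (fun e => mk M (Trip M (a e) (b e) (c e))).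
Proof. by move=> ha hb hc; exists a, b, c. Qed.

Lemma qdef_const k (u : Q) : QDef k (fun _ => u).
Proof.
have [[a b c] ->] := mk_surj M u.
by apply: qdef_mk; apply: term_const.
Qed.

Lemma qdef_add k F G : QDef k F -> QDef k G -> QDef k (fun e => F e + G e).
Proof.
move=> [a [b [c [ha [hb [hc h]]]]]] [a' [b' [c' [ha' [hb' [hc' h']]]]]].
do 3 eexists; split; last split; last split; last by move=> e; rewrite h h' mkD; reflexivity.
all: by term_def.
Qed.

Lemma qdef_opp k F : QDef k F -> QDef k (fun e => - F e).
Proof.
move=> [a [b [c [ha [hb [hc h]]]]]]; exists b, a, c; do 3 split=> //.
by move=> e; rewrite h mkN.
Qed.

Lemma def_qlt b k F G : QDef k F -> QDef k G -> Def M b k (fun e => F e < G e).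
Proof.
move=> [p [q [d [hp [hq [hd h]]]]]] [p' [q' [d' [hp' [hq' [hd' h']]]]]].
apply: (def_ext _ _ _ (fun e => qlt M (Trip M (p e) (q e) (d e)) (Trip M (p' e) (q' e) (d' e)))).
  by move=> e; rewrite h h' mk_lt.
by rewrite /qlt /=; def.
Qed.

Lemma def_mle b k f g : TermDef M k f -> TermDef M k g ->
  Def M b k (fun e => mle M (f e) (g e)).
Proof. by move=> hf hg; rewrite /mle; def. Qed.

Lemma def_all_q k (P : env M k -> Q -> Prop) :
  Def M true (S (S (S k))) (fun e => P e.1.1.1 (mk M (Trip M e.1.1.2 e.1.2 e.2))) ->
  Def M true k (fun e => forall u, P e u).
Proof.
move=> h; apply: (def_ext _ _ _ (fun e => forall a b c, P e (mk M (Trip M a b c)))).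
  move=> e; split=> // H u; have [[a b c] ->] := mk_surj M u; exact: H.
by do 3 apply: def_all.
Qed.

Lemma def_ex_q k (P : env M k -> Q -> Prop) :
  Def M true (S (S (S k))) (fun e => P e.1.1.1 (mk M (Trip M e.1.1.2 e.1.2 e.2))) ->
  Def M true k (fun e => exists u, P e u).
Proof.
move=> h; apply: (def_ext _ _ _ (fun e => exists a b c, P e (mk M (Trip M a b c)))).
  move=> e; split=> [[a [b [c H]]]|[u]]; first by exists (mk M (Trip M a b c)).
  by have [[a b c] ->] := mk_surj M u; exists a, b, c.
by do 3 apply: def_ex.
Qed.

(** [rc] is obtained by minimization and is not given by a term; its graph is defined by the two
    clauses of [is_code]. *)
Lemma def_rc k f F : TermDef M k f -> QDef k F -> Def M true k (fun e => f e = rc M (F e)).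
Proof.
move=> hf [p [q [d [hp [hq [hd h]]]]]].
apply: (def_ext _ _ _ (fun e => (exists a b c, qeq M (Trip M a b c) (Trip M (p e) (q e) (d e)) /\
    f e = trip_code M (Trip M a b c)) /\
  (forall a b c, qeq M (Trip M a b c) (Trip M (p e) (q e) (d e)) ->
    mle M (f e) (trip_code M (Trip M a b c))))).
{ move=> e; rewrite -rcP /is_code h; split.
  - move=> [[a [b [c [/mk_eq E E']]]] H]; split; first by exists (Trip M a b c).
    by move=> [a' b' c'] /mk_eq; apply: H.
  - move=> [[[a b c] [/mk_eq E E']] H]; split; first by exists a, b, c.
    by move=> a' b' c' /mk_eq; apply: H. }
have lift g : TermDef M k g -> TermDef M (S (S (S k))) (fun e => g e.1.1.1).
  move=> hg; apply: term_sub hg _.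
  exact: envdef_fst (envdef_fst _ _ _ _ (envdef_fst _ _ _ _ (envdef_id M k))).
have lf := lift _ hf; have lp := lift _ hp; have lq := lift _ hq; have ld := lift _ hd.
rewrite /qeq /trip_code /mpair /mle /=; def.
Qed.

End RationalDefinability.

Ltac q_def :=
  cbv beta;
  first [ assumption | apply: qdef_const | apply: qdef_add; q_def | apply: qdef_opp; q_def
        | apply: qdef_mk; term_def ].

Ltac qdef := repeat first
  [ apply: def_all_q | apply: def_ex_q | apply: def_qlt; q_def | apply: def_mle; term_def | apply: def_rc; [term_def|q_def]
  | def_step ].

(** * Finite subcovers by a supremum argument *)

Section Forward.
Variable M : rca.
Notation D := (carrier M).
Notation Q := (quot M).
Notation mle := (mle M).
Local Open Scope ring_scope.
Local Notation succ x := (madd M x (mone M)).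

Definition has_arithmetical_comprehension : Prop :=
  forall P, Def1 M true P -> exists X, forall x, mmem M x X <-> P x.

Definition grid (j m : D) : Q := mk M (Trip M j (mzero M) m).
Definition mesh (m : D) : Q := grid (mone M) m.

Lemma grid0 m : grid (mzero M) m = 0.
Proof. by apply/mk_eq; rewrite /qeq /= !mul0m. Qed.

Lemma grid_succ j m : grid (succ j) m = grid j m + mesh m.
Proof.
by rewrite /mesh /grid mkD; apply/mk_eq; apply: qeq_succ.
Qed.

Lemma grid_ge0 j m : 0 <= grid j m.
Proof. by rewrite leNgt; apply/negP => /mk_lt; rewrite /qlt /= !mul0m !addm0 => /ltm0. Qed.

Lemma mesh_gt0 m : 0 < mesh m.
Proof. by apply/mk_lt; rewrite /qlt /= !(mul0m, mul1m, addm0, add0m) -(add0m M (mone M)); apply: lt0S. Qed.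

Lemma mesh_le m m' : mle m m' -> mesh m' <= mesh m.
Proof.
move=> [h|->] //; apply: ltW; apply/mk_lt; rewrite /qlt /= !mul0m !addm0 !mul1m.
exact: ltSS.
Qed.

Lemma grid_top m : grid (succ m) m = 1.
Proof. by apply/mk_eq; rewrite /qeq /= !mul0m !addm0 add0m mul1m (mulmC M _ (mone M)) mul1m. Qed.

Lemma mesh_small (u : Q) : 0 < u -> exists m, mesh m < u.
Proof.
have [f ->] := mk_surj M u => /mk_lt /qlt_unit_fraction [m h].
by exists m; apply/mk_lt.
Qed.

Section Compactness.
Variable U : nat.

(** The codes are bound to [x] and [y], since [rc] may not occur inside a term; in this form
    [def_rc] applies. *)
Definition coded_ball (n i : D) (a r : Q) : Prop :=
  0 < r /\ exists x y, x = rc M a /\ y = rc M r /\ exists N, forall m, mle N m ->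
    mmem M (mpair M (mpair M n i) (mpair M m (mpair M x y))) U.

(** The two inequalities say [|a - p| + mesh m < r]. Strict inequalities between sums and opposites
    are the shape that [def_qlt] accepts, which is also why [good] writes [~ p < 0]. *)
Definition covers (n k m : D) (p : Q) : Prop :=
  exists i, mle i k /\ exists a r, coded_ball n i a r /\
    a + - p + mesh m < r /\ p + - a + mesh m < r.

(* [mesh m] is a Lebesgue number for a cover of [[0,q[]; quantifying over
   rational points makes the finite covering property arithmetical. *)
Definition good (n k : D) (q : Q) : Prop :=
  exists m, forall p, ~ p < 0 -> p < q -> covers n k m p.

Lemma def_good k n b F : TermDef M k n -> TermDef M k b -> QDef M k F ->
  Def M true k (fun e => good (n e) (b e) (F e)).
Proof.
move=> hn hb [p [q [d [hp [hq [hd E]]]]]].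
apply: (def_ext _ _ _ (fun e => good (n e) (b e) (mk M (Trip M (p e) (q e) (d e))))).
  by move=> e; rewrite E.
(* Proved once for five plain variables, which [term_def] finds by search, and then pulled back
   along the given terms. *)
have main : Def M true 5 (fun e => good e.1.1.1.1.2 e.1.1.1.2 (mk M (Trip M e.1.1.2 e.1.2 e.2))).
  rewrite /good /covers /coded_ball /mesh /grid /mpair; qdef.
apply: (def_sub _ _ _ 5 _ (fun e => (tt, n e, b e, p e, q e, d e)) main).
by do 5 (apply: envdef_pair => //); apply: envdef_tt.
Qed.

Definition Good (n : D) (q : Q) : Prop := exists k, good n k q.

Lemma covers_mono n k k' m m' p : mle k k' -> mle m m' -> covers n k m p -> covers n k' m' p.
Proof.
move=> lk /mesh_le lm [i [li [a [r [h [h1 h2]]]]]]; exists i; split.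
  exact: mle_trans lk.
by exists a, r; split=> //; split; lra.
Qed.

Lemma Good_le n q q' : q' <= q -> Good n q -> Good n q'.
Proof. by move=> l [k [m h]]; exists k, m => p p0 pq; apply: h => //; lra. Qed.

Lemma Good0 n : Good n 0.
Proof. by exists (mzero M), (mzero M) => p. Qed.

Hypothesis ACA : has_arithmetical_comprehension.

Lemma arithmetical_least (P : D -> Prop) n : Def1 M true P -> P n ->
  exists m, P m /\ forall k, mlt M k m -> ~ P k.
Proof.
move=> /ACA [X hX] /hX h; have [|m [/hX hm l]] := Delta0_least M (fun x => mmem M x X) n _ h.
  by def.
by exists m; split=> // k /l hk /hX.
Qed.

(** The least bad grid point is written as [grid (succ j) m]: the grid point 0 is always good, so a
    bad one has a predecessor, and that predecessor [grid j m] is good. *)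
Definition is_sup_step (n m j : D) : Prop :=
  ~ Good n (grid (succ j) m) /\ forall j', mlt M j' j -> Good n (grid (succ j') m).

(* [xs m] is the last multiple of 1/(m+1) that is good. *)
Lemma sup_sequence n : ~ Good n 1 -> exists X xs, graph M X xs /\
  forall m, 0 <= xs m /\ Good n (xs m) /\ ~ Good n (xs m + mesh m).
Proof.
move=> nG.
have dG (b : D -> D) k t f : TermDef M k t -> TermDef M k f -> Def M true k (fun e => Good n (grid (t e) (f e))).
  move=> ht hf; apply: def_ex; apply: def_good; [exact: term_const|by term_def|].
  apply: qdef_mk; [|exact: term_const|]; apply: term_sub;
    [exact: ht|exact: envdef_fst (envdef_id M k)|exact: hf|exact: envdef_fst (envdef_id M k)].
have H m : exists j, is_sup_step n m j.
(* The search can start from [m] itself, as [grid (succ m) m] is 1. *)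
{ have [||j [hj lj]] := arithmetical_least (fun j => ~ Good n (grid (succ j) m)) m.
  - by apply: def_not; apply: dG => //; term_def.
  - by rewrite grid_top.
  - by exists j; split=> // j' /lj /NNPP. }
pose J m := sval (cid (H m)).
have HJ m : is_sup_step n m (J m) by rewrite /J; case: cid.
have uJ m j : is_sup_step n m j -> j = J m.
{ move=> [h l]; have [h' l'] := HJ m; case: (ltm_total M j (J m)) => [/l'|[|/l]] //. }
have [|X hX] := ACA (fun k => exists m j x, is_sup_step n m j /\ x = rc M (grid j m) /\ k = mpair M m x).
  rewrite /is_sup_step /mpair; do 3 apply: def_ex; apply: def_and.
    apply: def_and; first by apply: def_not; apply: dG => //; term_def.
    by apply: def_ball; [term_def|apply: dG => //; term_def].
  by rewrite /grid; qdef.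
exists X, (fun m => grid (J m) m); split.
  move=> k; rewrite hX; split=> [[m [j [x [/uJ -> [-> ->]]]]]|[m ->]]; first by exists m.
  by exists m, (J m), (rc M (grid (J m) m)).
move=> m; have [h l] := HJ m; split; first exact: grid_ge0.
split; last by rewrite -grid_succ.
case: (zeroVsucc M (J m)) => [->|[j e]]; first by rewrite grid0; apply: Good0.
by rewrite e; apply: l; rewrite e; apply/ltmS; right.
Qed.

(** Points from [q] up to [q + mesh m] are within [e/4] of [q], so the ball covers them with more
    than [3e/4] to spare, which exceeds the new Lebesgue number [mesh l]. Points below [q] keep
    their old balls. *)
Lemma Good_extend n q i a r e m : coded_ball n i a r -> 0 < e -> `|a - q| + e <= r ->
  mesh m < e / 4%:R -> Good n q -> Good n (q + mesh m).
Proof.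
move=> hb e0 hr hm [k [m' h]].
have [k' [lk li]] := mle_max M k i; have [l [lm lm']] := mle_max M m m'.
exists k', l => p p0 pq; have [pq'|qp] := ltrP p q.
  by apply: covers_mono (h p p0 pq').
exists i; split=> //; exists a, r; split=> //.
have := mesh_le _ _ lm; move: hr hm pq; case: (norm_cases _ (a - q)) => -[? ->] *; split; lra.
Qed.

Lemma unit_interval_good n :
  (forall X xs, graph M X xs -> in_unit M xs -> exists i, open_mem M U n i xs) ->
  exists k, good n k 1.
Proof.
move=> hcov; apply: NNPP => nG.
have [X [xs [gX hxs]]] := sup_sequence n nG.
have lt1 m : xs m < 1.
  by rewrite ltNge; apply/negP => h; apply: nG; apply: Good_le h _; case: (hxs m) => _ [].
(* A good point lies below every bad one because goodness is inherited downwards. Using this both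
   ways bounds the distance of two terms by the larger mesh. *)
have close m m' : xs m < xs m' + mesh m'.
  rewrite ltNge; apply/negP => h; have [_ [g _]] := hxs m; have [_ [_ b]] := hxs m'.
  by apply: b; apply: Good_le h g.
have cX : cauchy M xs.
  move=> e e0; have [N hN] := mesh_small e e0; exists N => m m' /mesh_le lm /mesh_le lm'.
  by have := close m m'; have := close m' m; move: (xs m) (xs m') lm lm' hN => x y; norm_lra.
have uX : in_unit M xs.
  split=> //; split=> e e0; exists (mzero M) => m _.
    by have [h _] := hxs m; lra.
  by have := lt1 m; lra.
have [i [N [a [r [r0 [/(ball_mem_margin _ _ _ _ cX) [e [e0 [N' he]]] hU]]]]]] := hcov X xs gX uX.
have [|m0 hm0] := mesh_small (e / 4%:R); first by lra.
have [m [lm lm']] := mle_max M m0 N'.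
have [_ [g b]] := hxs m; apply: b.
apply: (Good_extend n (xs m) i a r e) => //.
- by split=> //; exists (rc M a), (rc M r); do 2 split=> //; exists N.
- exact: he.
- exact: le_lt_trans (mesh_le _ _ lm) hm0.
Qed.

Lemma good_open_mem n k xs : good n k 1 -> in_unit M xs ->
  exists i, mle i k /\ open_mem M U n i xs.
Proof.
move=> [m hm] [cX [h0 h1]].
(* The Lebesgue number is spent in quarters: two for the distance from [p] to [xs N], one for the
   Cauchy tail, and one as the margin in [ball_mem_margin]. *)
have mp := mesh_gt0 m; set d := mesh m / 4%:R.
have d0 : 0 < d by rewrite /d; lra.
have [N0 hN0] := cX _ d0.
have [N1 hN1] := eventually_and M _ _ (h0 _ d0) (h1 _ d0).
have [N [lN0 lN1]] := mle_max M N0 N1; have [lo hi] := hN1 N lN1.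
have [p [p0 [p1 hp]]] : exists p : Q, 0 <= p /\ p < 1 /\ `|p - xs N| <= d + d.
(* [x] is at most [1 + d], so lowering it by [2d] gives a point strictly below 1, as [good] demands.
   If that point is negative, then [x] lies between [-d] and [2d], and 0 will do. *)
{ move: (xs N) lo hi => x lo hi; have [h|h] := lerP 0 (x - (d + d)).
  - by exists (x - (d + d)); split=> //; split; [lra|norm_lra].
  - by exists 0; split=> //; split; [lra|norm_lra]. }
have [||i [li [a [r [[r0 [x [y [-> [-> [K hK]]]]]] [ar ra]]]]]] := hm p; first by apply/negP; rewrite -leNgt.
  by [].
exists i; split=> //; exists K, a, r; split=> //; split=> //.
apply/ball_mem_margin => //; exists d; split=> //; exists N0 => j lj.
have := hN0 N j lN0 lj; move: hp ar ra d0; rewrite /d.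
by move: (xs N) (xs j) (mesh m) => x' y' w; norm_lra.
Qed.

End Compactness.

Lemma arithmetical_comprehension_heine_borel :
  has_arithmetical_comprehension -> heine_borel M.
Proof.
move=> ACA U _ hcov.
(* Minimality singles out one value for each [n], so comprehension yields a function without any
   choice inside the model. *)
pose L n k := good U n k 1 /\ forall k', mlt M k' k -> ~ good U n k' 1.
have [|H hH] := ACA (fun x => exists n k, L n k /\ x = mpair M n k).
  rewrite /L /mpair; do 2 apply: def_ex; apply: def_and; last by def.
  apply: def_and; first by apply: def_good; [term_def|term_def|exact: qdef_const].
  by apply: def_ball; [term_def|apply: def_not; apply: def_good; [term_def|term_def|exact: qdef_const]].
have uL n k k' : L n k -> L n k' -> k' = k.
  by move=> [g l] [g' l']; case: (ltm_total M k k') => [/l'|[|/l]].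
have eL n : exists k, L n k.
  have [k hk] := unit_interval_good U ACA n (hcov n).
  have [|j [hj lj]] := arithmetical_least ACA (fun k => good U n k 1) k _ hk; last by exists j.
  by apply: def_good; [exact: term_const|term_def|exact: qdef_const].
have mH n k : mmem M (mpair M n k) H <-> L n k.
  by rewrite hH; split=> [[n' [k' [h /mpair_inj [-> ->]]]]|h] //; exists n, k.
exists H; split; first split.
- by move=> x /hH [n [k [_ ->]]]; exists n, k.
- move=> n; have [k hk] := eL n; exists k; split; first exact/mH.
  by move=> k' /mH; apply: uL.
- by move=> n k /mH [g _] X xs _; apply: good_open_mem.
Qed.

End Forward.

Theorem proposition5p16 :
  equivalent_over RCA0
    (fun p => p = uniform_heine_borel)
    arithmetical_comprehension.
Proof.
split=> p hp; apply: completeness => M s ns hM.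
- have hR : models M RCA0 by move=> q s' r h; apply: hM; left.
  case: hp => q aq; pose R := Rca M s ns hR.
  apply: (heine_borel_comprehension R q) aq.
  by apply/(sat_heine_borel R s (fun n => n)); apply: hM; right.
- have hR : models M RCA0 by move=> q s' r h; apply: hM; left.
  pose R := Rca M s ns hR; rewrite hp; apply/(sat_heine_borel R).
  apply: arithmetical_comprehension_heine_borel => P [q [aq E]].
  (* In [R] the assignment [s] supplies the names, so this instance of comprehension reads [q] with
     exactly the parameters that define [P]. *)
  have [X hX] : exists X, forall x, mmem R x X <-> satid R (scons x s) q.
    by apply: sat_comprehension; apply: hM; right.
  by exists X => x; rewrite hX -(E (tt, x)).
Qed.
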